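(* Let $n\ge2$ and let $\phi\colon[0,\infty)\to[0,\infty)$ be a modulus of continuity function satisfying conditions $(\mathbf C_1)$, $(\mathbf C_2)$, $(\mathbf C_3)$ and $(\mathbf C_4)$ listed in the context. Then there exists a homeomorphism $H\colon\mathbb R^n\to\mathbb R^n$ (onto) of Sobolev class $\mathscr W^{1,n}_{\rm loc}(\mathbb R^n,\mathbb R^n)$ whose inverse $F=H^{-1}$ also lies in $\mathscr W^{1,n}_{\rm loc}(\mathbb R^n,\mathbb R^n)$, and moreover: 1. $H(0)=0$, and $H(X)=X$ whenever $\|X\|\ge1$ and whenever $X=(x_1,\dots,x_{n-1},0)$; 2. $H$ admits $\phi$ as its global modulus of continuity: there is a constant $C$ such that $\|H(X_1)-H(X_2)\|\le C\,\phi(\|X_1-X_2\|)$ for all $X_1,X_2\in\mathbb R^n$; 3. $F$ satisfies the same condition: there is a constant $C$ such that $\|F(Y_1)-F(Y_2)\|\le C\,\phi(\|Y_1-Y_2\|)$ for all $Y_1,Y_2\in\mathbb R^n$; 4. $H$ and $F$ share the same optimal modulus of continuity at the origin: for all $0\le r<\infty$, $$\omega_H(0,r)=\max_{\|X\|=r}|H(X)|=\phi(r)=\max_{\|Y\|=r}|F(Y)|=\omega_F(0,r).$$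
   Context: Write $\mathbb R^n=\mathbb R^{n-1}\times\mathbb R$, $X=(x,t)$; $|\cdot|$ is the Euclidean norm and $\|X\|=|x|+|t|$. The symbols $\omega_H(0,r)$ and $\omega_F(0,r)$ denote the optimal moduli of continuity at the origin, given by the maxima displayed in item 4. A modulus of continuity function is a continuous strictly increasing function on $[0,\infty)$ vanishing at $0$. The conditions on $\phi$ are as follows; $\phi$ maps $[0,1]$ onto $[0,1]$, with $\phi\in\mathscr C[0,1]\cap\mathscr C^1(0,1]$, and $(\mathbf C_1)$ $\phi(0)=0$, $\phi(1)=1$, and $\phi(s)=s$ for $s\ge1$. $(\mathbf C_2)$ There is a constant $1\le M<\infty$ with $\phi'(s)\le\frac{\phi(s)}{s}\le M[\phi'(s)]^2$ for $0<s\le1$. $(\mathbf C_3)$ $E[\phi]=\int_0^1|\phi(s)|^n\frac{ds}{s}<\infty$. $(\mathbf C_4)$ There is an interval $(0,r_0]\subset(0,1]$ in which $\phi$ is $\mathscr C^2$-smooth and concave, i.e. $\phi''(s)\le0$ for $0<s\le r_0$. *)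

(* Defs.v *)
From HB Require Import structures.
From mathcomp Require Import all_boot all_order all_algebra.
From mathcomp Require Import all_classical all_reals all_analysis.

Set Implicit Arguments.
Unset Strict Implicit.
Unset Printing Implicit Defensive.

Import Order.TTheory GRing.Theory Num.Theory.
Import numFieldNormedType.Exports.

Local Open Scope classical_set_scope.
Local Open Scope ring_scope.

(** * Norms on R^n = R^(n-1) * R, with X = (x, t), t the last coordinate

    The library topology of ['rV[R]_n] is that of the sup norm, hence the usual
    one; the library norm itself is never used. *)

Section norms.
Context {R : realType} {n : nat}.
Implicit Type X : 'rV[R]_n.

Definition enorm X : R := Num.sqrt (\sum_(i < n) X 0 i ^+ 2).

(* t, written as a sum with one term so that no shape is imposed on n > 0 *)
Definition height X : R := \sum_(i < n | i.+1 == n) X 0 i.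

(* the Euclidean norm |x| in R^(n-1) *)
Definition horiz_norm X : R := Num.sqrt (\sum_(i < n | i.+1 != n) X 0 i ^+ 2).

(* ||X|| = |x| + |t| *)
Definition tnorm X : R := horiz_norm X + `|height X|.

End norms.

(** * Lebesgue measure on R^n *)

Definition rV_display : measure_display. Proof. exact: default_measure_display. Qed.

(* The sigma-algebra generated by the coordinates, i.e. the Borel one. *)
Section rV_measurable.
Context {R : realType} {n : nat}.

Let coord (i : 'I_n) (v : 'rV[R]_n) : R := v 0 i.

Let rV_set0 : g_sigma_preimage coord set0.
Proof. exact: sigma_algebra0. Qed.

Let rV_setC A : g_sigma_preimage coord A -> g_sigma_preimage coord (~` A).
Proof. exact: sigma_algebraC. Qed.

Let rV_bigcup (F : (set 'rV[R]_n)^nat) :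
  (forall i, g_sigma_preimage coord (F i)) ->
  g_sigma_preimage coord (\bigcup_i (F i)).
Proof. exact: sigma_algebra_bigcup. Qed.

HB.instance Definition _ := @isMeasurable.Build rV_display
  'rV[R]_n (g_sigma_preimage coord) rV_set0 rV_setC rV_bigcup.

End rV_measurable.

Lemma measurable_coord (R : realType) n (i : 'I_n) :
  measurable_fun [set: 'rV[R]_n] (fun v : 'rV[R]_n => v 0 i).
Proof.
move=> _ Y mY; rewrite setTI; apply: sub_sigma_algebra => /=.
rewrite -bigcup_seq/=; exists i => /=; first by rewrite mem_index_enum.
by exists Y => //; rewrite setTI.
Qed.

Lemma measurable_rVP d (T : measurableType d) (R : realType) n
    (f : T -> 'rV[R]_n) :
  (forall i, measurable_fun [set: T] (fun x => f x 0 i)) ->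
  measurable_fun [set: T] f.
Proof.
move=> mf.
suff mfS : g_sigma_preimage (fun (i : 'I_n) x => f x 0 i) `<=` measurable.
  move=> _ A mA; rewrite setTI; apply: mfS.
  have -> : (fun (i : 'I_n) x => f x 0 i) =
            (fun i => (fun v : 'rV[R]_n => v 0 i) \o f) by [].
  by rewrite g_sigma_preimage_comp; exists A => //; rewrite setTI.
apply: smallest_sub; first exact: sigma_algebra_measurable.
case: n => [|n] in f mf *; first by rewrite big_ord0.
rewrite -bigcup_mkord_ord; apply: bigcup_sub => i Ii.
by move=> A [B mB <-]; exact: mf.
Qed.

(* the bijection R^n * R -> R^(n+1), (x, t) |-> (x_0, ..., x_(n-1), t) *)
Definition snoc_rV (R : realType) n (p : 'rV[R]_n * R) : 'rV[R]_n.+1 :=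
  \row_(i < n.+1) oapp (fun j => p.1 0 j) p.2 (unlift ord_max i).

Lemma measurable_snoc_rV (R : realType) n :
  measurable_fun [set: 'rV[R]_n * R] (@snoc_rV R n).
Proof.
apply: measurable_rVP => i; under eq_fun do rewrite mxE.
case: (unlift ord_max i) => [j|] /=; last exact: measurable_snd.
by apply: (measurableT_comp (@measurable_coord R n j)); exact: measurable_fst.
Qed.

Definition leb_step (R : realType) n
    (mu : {measure set 'rV[R]_n -> \bar R}) : set 'rV[R]_n.+1 -> \bar R :=
  pushforward (mu \x (@lebesgue_measure R))%E (@snoc_rV R n).

HB.instance Definition _ (R : realType) n
    (mu : {measure set 'rV[R]_n -> \bar R}) := Measure.copy (leb_step mu)
  (measure_function_pushforward__canonical__measure_function_Measure
    (mu \x (@lebesgue_measure R))%E (@measurable_snoc_rV R n)).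

Fixpoint leb (R : realType) n : {measure set 'rV[R]_n -> \bar R} :=
  if n is m.+1 then leb_step (leb R m) else dirac (0 : 'rV[R]_0).

Lemma leb_box (R : realType) n (a b : 'rV[R]_n) :
  (forall i, a 0 i <= b 0 i) ->
  leb R n [set v : 'rV[R]_n | forall i, v 0 i \in `[a 0 i, b 0 i]] =
  (\prod_(i < n) (b 0 i - a 0 i))%:E.
Proof.
elim: n a b => [|n IH] a b ab.
  by rewrite big_ord0 /= diracE mem_set//; case.
pose a' : 'rV[R]_n := \row_i a 0 (lift ord_max i).
pose b' : 'rV[R]_n := \row_i b 0 (lift ord_max i).
have -> : leb R n.+1 [set v : 'rV[R]_n.+1 | forall i, v 0 i \in `[a 0 i, b 0 i]] =
    ((leb R n) \x (@lebesgue_measure R))%E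
      ([set v : 'rV[R]_n | forall i, v 0 i \in `[a' 0 i, b' 0 i]] `*`
       `[a 0 ord_max, b 0 ord_max]).
  rewrite /= /leb_step /pushforward; congr product_measure1.
  apply/seteqP; split=> -[v t] /=.
    move=> h; split=> [i|]; last by have := h ord_max; rewrite mxE unlift_none.
    by have := h (lift ord_max i); rewrite !mxE liftK.
  move=> [h1 h2] i; rewrite mxE; case: unliftP => [j|] -> //=.
  by have := h1 j; rewrite !mxE.
rewrite product_measure1E//; last first.
  have -> : [set v : 'rV[R]_n | forall i, v 0 i \in `[a' 0 i, b' 0 i]] =
      \bigcap_(i in [set: 'I_n])
        ((fun v : 'rV[R]_n => v 0 i) @^-1` `[a' 0 i, b' 0 i]).
    by apply/seteqP; split=> v /= h i; [move=> _; exact: h|exact: (h i)].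
  apply: fin_bigcap_measurable; first exact: finite_finset.
  by move=> i _; rewrite -[X in measurable X]setTI; exact: measurable_coord.
rewrite IH; last by move=> i; rewrite !mxE.
have mu1 : (@lebesgue_measure R) `[a 0 ord_max, b 0 ord_max] =
    (b 0 ord_max - a 0 ord_max)%:E.
  rewrite lebesgue_measure_itv/= lte_fin; have := ab ord_max.
  rewrite le_eqVlt => /predU1P[->|->]; last by rewrite -EFinB.
  by rewrite ltxx subrr.
rewrite big_ord_recr EFinM; congr (_ * _)%E; last exact: mu1.
congr EFin; apply: eq_bigr => i _; rewrite !mxE.
by have -> : lift ord_max i = widen_ord (leqnSn n) i
  by apply/val_inj; rewrite /= /bump leqNgt ltn_ord.
Qed.

(** * The Sobolev class W^{1,p}_loc(R^n, R^m) *)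

Section sobolev.
Context {R : realType} {n : nat}.
Implicit Types (f g eta : 'rV[R]_n -> R) (i : 'I_n).

Definition partial i f : 'rV[R]_n -> R := fun x => 'D_(delta_mx 0 i) f x.

Definition iter_partial (s : seq 'I_n) f : 'rV[R]_n -> R := foldr partial f s.

Definition smooth f : Prop := forall s : seq 'I_n,
  continuous (iter_partial s f) /\
  forall i x, derivable (iter_partial s f) x (delta_mx 0 i).

(* C_c^oo(R^n) *)
Definition test_function eta : Prop :=
  smooth eta /\ compact (closure [set x | eta x != 0]).

(* [measurable_fun] is Borel measurability: every L^p_loc class has a Borel
   representative *)
Definition Lp_loc (p : nat) f : Prop :=
  measurable_fun [set: 'rV[R]_n] f /\
  forall K : set 'rV[R]_n, compact K ->
    (\int[leb R n]_(x in K) (`|f x| ^+ p)%:E < +oo)%E.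

Definition weak_partial i f g : Prop :=
  forall eta, test_function eta ->
    (\int[leb R n]_x (f x * partial i eta x)%:E =
     - \int[leb R n]_x (g x * eta x)%:E)%E.

Definition W1p_loc_fun (p : nat) f : Prop :=
  Lp_loc p f /\ forall i, exists2 g, Lp_loc p g & weak_partial i f g.

Definition W1p_loc (p : nat) m (F : 'rV[R]_n -> 'rV[R]_m) : Prop :=
  forall j : 'I_m, W1p_loc_fun p (fun x => F x 0 j).

End sobolev.

(** * Calculus on an interval, with one-sided derivatives at its end points *)

Section calculus_on.
Context {R : realType}.
Implicit Types (A : set R) (f : R -> R) (x : R).

Definition diff_quot f x (y : R) : R := (f y - f x) / (y - x).

Definition derivable_on A f x : Prop := cvg (diff_quot f x @ within A x^').

Definition derive_on A f x : R := lim (diff_quot f x @ within A x^').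

Definition C1_on A f : Prop :=
  (forall x, A x -> derivable_on A f x) /\
  {within A, continuous (derive_on A f)}.

Definition C2_on A f : Prop := C1_on A f /\ C1_on A (derive_on A f).

End calculus_on.

(** * Conditions on phi, a function on [0, +oo[ (values at s < 0 are junk) *)

Section phi_conditions.
Context {R : realType}.
Variable phi : R -> R.

Definition modulus_of_continuity : Prop :=
  [/\ {within `[0, +oo[, continuous phi},
      {in `[0, +oo[ &, {homo phi : s t / s < t}} & phi 0 = 0].

Definition phi_regular : Prop :=
  [/\ phi @` `[0, 1] = `[0, 1]%classic, {within `[0, 1], continuous phi} &
      C1_on `]0, 1] phi].

Definition cond_C1 : Prop :=
  [/\ phi 0 = 0, phi 1 = 1 & forall s, 1 <= s -> phi s = s].

(* phi' is the derivative relative to ]0, 1], hence a left derivative at 1,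
   where phi need not be differentiable *)
Definition cond_C2 : Prop :=
  let phi' := derive_on `]0, 1] phi in
  exists2 M : R, 1 <= M & forall s, 0 < s <= 1 ->
    phi' s <= phi s / s <= M * phi' s ^+ 2.

Definition cond_C3 (n : nat) : Prop :=
  (\int[lebesgue_measure]_(s in `]0%R, 1%R]) (`|phi s| ^+ n / s)%:E < +oo)%E.

Definition cond_C4 : Prop :=
  exists r0 : R, [/\ 0 < r0 <= 1, C2_on `]0, r0] phi &
    forall s, 0 < s <= r0 -> derive_on `]0, r0] (derive_on `]0, r0] phi) s <= 0].

End phi_conditions.

(** * Homeomorphisms and moduli of continuity of maps of R^n *)

Section moduli.
Context {R : realType} {n : nat}.
Implicit Types H F : 'rV[R]_n -> 'rV[R]_n.

(* H is a homeomorphism of R^n onto itself, with inverse F *)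
Definition homeomorphism_with_inverse H F : Prop :=
  [/\ continuous H, continuous F, cancel H F & cancel F H].

Definition has_global_modulus (phi : R -> R) H : Prop :=
  exists C : R, forall X1 X2, tnorm (H X1 - H X2) <= C * phi (tnorm (X1 - X2)).

Definition is_max (A : set R) (m : R) : Prop := A m /\ ubound A m.

(* w is the optimal modulus of continuity of H at the origin at scale r, i.e.
   w = omega_H(0, r) = max_{||X|| = r} |H(X)|, for H with H(0) = 0; note that
   it mixes the norms ||.|| and |.| *)
Definition optimal_modulus0 H (r w : R) : Prop :=
  is_max [set enorm (H X) | X in [set X | tnorm X = r]] w.

End moduli.

(* Main.v *)
From HB Require Import structures.
Require Import Defs.
From mathcomp Require Import all_boot all_order all_algebra.
From mathcomp Require Import all_classical all_reals all_analysis.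
From mathcomp Require Import measurable_realfun ring lra.

Set Implicit Arguments.
Unset Strict Implicit.
Unset Printing Implicit Defensive.

Import Order.TTheory GRing.Theory Num.Theory.
Import numFieldNormedType.Exports.

Local Open Scope classical_set_scope.
Local Open Scope ring_scope.

(** Write X = (x, t), s = |x|, rho = s + |t| and slope(r) = phi(r)/r. Only three
    consequences of the hypotheses on phi matter: slope is nonincreasing, phi' is
    bounded below by some c > 0, and slope(||X||)^n is locally integrable, the last
    one being (C_3). The map only moves the last coordinate,
    H(x, t) = (x, u(|x|, t)), where for t >= 0
      u(s, t) = min (phi(s + t) - s) (2 t slope(max s t)),
    so that u(0, t) = phi(t), u(s, 0) = 0, u(s, t) = t as soon as s + t >= 1, and
    s + u(s, t) <= phi(s + t). For t < 0 one puts u(s, t) = - v(s, - t), where v(s, .)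
    is the inverse of u(s, .) on the half-line. Then F = H^-1 is the conjugate of H by the
    reflection t |-> - t, and H stretches on the upper half-space exactly as F does on
    the lower one.

    Each of the two functions in the minimum increases along the cone directions
    (s', t + |s' - s| / c), and so does u; hence v is Lipschitz. All estimates
    on H then follow from the single bound
      |H(X) - H(Y)| <= C slope(||X||) ||X - Y||,
    which gives the modulus of continuity because slope is nonincreasing. It also
    gives the Sobolev regularity: the difference quotients are dominated by a multiple of
    slope(||X||), which is in L^n_loc, and they converge almost everywhere since on
    every vertical line off the axis x = 0 the function u has partial derivatives
    except at finitely many points; the integration by parts passes to the limit by
    dominated convergence. *)

(** * A modulus of continuity satisfying (C_1) and (C_2) *)

(** At an interior point, [A] is a neighbourhood of [x], so restricting the punctured filter to [A]
    changes nothing. Carathéodory's criterion then applies to the difference quotient, completed at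
    [x] by its limit. *)
Lemma interior_derive_on (R : realType) (A : set R) (f : R -> R) (x : R) :
  A° x -> derivable_on A f x -> is_derive x 1 f (derive_on A f x).
Proof.
move=> Ax; rewrite /derivable_on /derive_on.
have -> : within A x^' = x^'.
  apply/seteqP; split=> P /=; last by rewrite /within /=; apply: filterS => y.
  rewrite /within/= /dnbhs /within/= => h.
  have {}Ax : nbhs x A by exact: Ax.
  by apply: filterS2 Ax h => y Ay hy yx; exact: hy.
move=> cv; apply/is_derive1_caratheodory.
exists (fun z => if z == x then lim (diff_quot f x @ x^') else diff_quot f x z).
split.
- move=> z; case: eqP => [->|/eqP]; first by rewrite !subrr mulr0.
  by rewrite -subr_eq0 => zx; rewrite /diff_quot divfK.
- apply/continuous_withinNx; rewrite eqxx.
  apply: cvg_trans cv; apply: near_eq_cvg.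
  by near=> z; rewrite ifF//; apply/negbTE; near: z; exact: nbhs_dnbhs_neq.
- by rewrite eqxx.
Unshelve. all: by end_near. Qed.

Section conditions.
Context {R : realType}.
Variable phi : R -> R.
Hypotheses (phi_mod : modulus_of_continuity phi) (phi_reg : phi_regular phi)
  (phi1 : cond_C1 phi) (phi2 : cond_C2 phi).

Let phi' := derive_on `]0, 1] phi.

Let phi_is_derive (s : R) : 0 < s < 1 -> is_derive s 1 phi (phi' s).
Proof.
move=> /andP[s0 s1]; apply: interior_derive_on.
  have h : s \in `]0, 1[ by rewrite in_itv/= s0.
  apply: filterS (near_in_itvoo h) => y /=.
  by rewrite !in_itv/= => /andP[-> /ltW].
by case: phi_reg => _ _ [+ _]; apply; rewrite /= in_itv/= s0 ltW.
Qed.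

Let phi'_ge0 (s : R) : 0 < s < 1 -> 0 <= phi' s.
Proof.
move=> s01; have ds := phi_is_derive s01.
rewrite -[phi' s](@derive_val _ _ _ _ _ _ _ ds) -derive1E.
apply: (@incr_derive1_ge0_itv _ phi true false 0 1).
- by move=> x; rewrite inE/= in_itv/= => x01; have := phi_is_derive x01; case.
- move=> x y; rewrite !in_itv/= => /andP[x0 _] /andP[y0 _] xy.
  by case: phi_mod => _ + _; apply => //; rewrite in_itv/= andbT.
- by rewrite in_itv/=.
Qed.

(** The derivative of phi(s)/s is (phi'(s) - phi(s)/s)/s, which is nonpositive by the first
    inequality of [cond_C2]. Beyond 1 the ratio is constantly 1, its value at 1. *)
Lemma modulus_slope_nonincreasing (s t : R) : 0 < s -> s <= t -> phi t / t <= phi s / s.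
Proof.
move=> s0; rewrite le_eqVlt => /predU1P[-> //|st].
have [ph0 ph1 phid] := phi1.
have le1 u v : 0 < u -> u < v -> v <= 1 -> phi v / v <= phi u / u.
  move=> u0 uv v1.
  have dr x : x \in `]u, v[ -> is_derive x 1 (fun x => phi x / x)
      (phi' x / x - phi x / x ^+ 2).
    rewrite in_itv/= => /andP[ux xv].
    have x0 : 0 < x by lra.
    have dp : is_derive x 1 phi (phi' x) by apply: phi_is_derive; lra.
    have di : is_derive x 1 (fun y : R => y^-1) (- x ^- 2 *: 1).
      by apply: is_deriveV; rewrite gt_eqF.
    apply: (is_derive_eq (is_deriveM dp di)).
    rewrite /GRing.scale/=.
    by field; lra.
  have cts : {within `[u, v], continuous (fun x => phi x / x)}.
    have c1 : {within `[u, v], continuous phi}.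
      case: phi_mod => + _ _; apply: continuous_subspaceW => x /=.
      by rewrite !in_itv/= => /andP[ux _]; lra.
    have c2 : {within `[u, v], continuous (fun x : R => x^-1)}.
      apply: continuous_in_subspaceT => x; rewrite inE/= in_itv/= => /andP[ux _].
      by apply: inv_continuous; lra.
    by move=> x; apply: continuousM; [exact: c1|exact: c2].
  have [c] := MVT uv dr cts.
  rewrite in_itv/= => /andP[uc cv] /eqP; rewrite subr_eq => /eqP ->.
  case: phi2 => M M1 h.
  have c01 : 0 < c <= 1 by lra.
  have /andP[h1 _] := h _ c01.
  have : phi' c / c - phi c / c ^+ 2 <= 0.
    have -> : phi' c / c - phi c / c ^+ 2 = (phi' c - phi c / c) / c.
      by field; lra.
    by rewrite mulr_le0_ge0// ?subr_le0// invr_ge0; lra.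
  by nra.
have [t1|t1] := leP t 1; first exact: le1.
rewrite phid; last lra.
rewrite divff; last lra.
have [s1|s1] := leP 1 s; first by rewrite phid// divff//; lra.
have := le1 s 1 s0 s1 (lexx _); rewrite ph1 divr1; exact.
Qed.

(** The constant is 1/M. Monotonicity of the ratio gives phi(x)/x >= 1, so the second inequality of
    [cond_C2] yields M phi'(x)^2 >= 1; with phi' >= 0 and M >= 1 this excludes phi'(x) < 1/M. *)
Let phi'_lb : exists2 c, 0 < c <= 1 & forall x, 0 < x < 1 -> c <= phi' x.
Proof.
have [ph0 ph1 phid] := phi1.
case: phi2 => M M1 h.
have M0 : 0 < M by lra.
exists M^-1 => [|x x01]; first by rewrite invr_gt0 invf_le1 ?M0.
have iM1 : M^-1 <= 1 by rewrite invf_le1.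
have d0 := phi'_ge0 x01.
have x01' : 0 < x <= 1 by lra.
have /andP[_ h2] := h _ x01'.
have r1 : 1 <= phi x / x.
  have := @modulus_slope_nonincreasing x 1; rewrite ph1 divr1; apply; lra.
rewrite -(@ler_pM2l _ M)// mulfV ?gt_eqF//.
rewrite -/phi' in h2.
have : 1 <= M * phi' x ^+ 2 by lra.
by nra.
Qed.

(** Mean value theorem below 1 and the identity above 1, glued at 1; c <= 1 serves the second
    piece. *)
Lemma modulus_expanding : exists2 c, 0 < c <= 1 &
  forall u v : R, 0 <= u -> u <= v -> c * (v - u) <= phi v - phi u.
Proof.
have [ph0 ph1 phid] := phi1.
have [c c01 derb] := phi'_lb.
exists c => // u v u0.
have le1 a b : 0 <= a -> a < b -> b <= 1 -> c * (b - a) <= phi b - phi a.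
  move=> a0 ab b1.
  have dr x : x \in `]a, b[ -> is_derive x 1 phi (phi' x).
    by rewrite in_itv/= => /andP[ux xv]; apply: phi_is_derive; lra.
  have c1 : {within `[a, b], continuous phi}.
    case: phi_mod => + _ _; apply: continuous_subspaceW => x /=.
    by rewrite !in_itv/= => /andP[ux _]; lra.
  have [x + ->] := MVT ab dr c1.
  rewrite in_itv/= => /andP[ac cb].
  by rewrite ler_pM2r ?subr_gt0//; apply: derb; lra.
rewrite le_eqVlt => /predU1P[<-|uv]; first by rewrite !subrr mulr0.
have [v1|v1] := leP v 1; first exact: le1.
have [u1|u1] := leP 1 u.
  by rewrite !phid; nra.
have := le1 u 1 u0 u1 (lexx _); rewrite ph1 (phid v); nra.
Qed.

Lemma modulus_onto (y : R) : 0 <= y -> exists2 x, 0 <= x & phi x = y.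
Proof.
move=> y0; have [y1|y1] := leP y 1; last first.
  by exists y; [lra|case: phi1 => _ _ ->//; lra].
case: phi_reg => im _ _.
have : [set` `[0, 1]] y by rewrite /= in_itv/= y0.
by rewrite -im => -[x]; rewrite /= in_itv/= => /andP[x0 _] <-; exists x.
Qed.

(** The point 1 is excluded because phi may have a kink there: the derivative from the left need not
    be 1. *)
Lemma modulus_is_derive (s : R) : 0 < s -> s != 1 ->
  exists2 l, 0 < l & is_derive s 1 phi l.
Proof.
move=> s0 s1; have [lt1|ge1] := ltP s 1.
  have s01 : 0 < s < 1 by rewrite s0.
  have [c /andP[c0 _] /(_ _ s01) cl] := phi'_lb.
  by exists (phi' s); [exact: lt_le_trans cl|exact: phi_is_derive].
exists 1 => //; apply: (@near_eq_is_derive _ _ _ id).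
near=> z; case: phi1 => _ _ -> //; apply: ltW.
by near: z; apply: lt_nbhsr; rewrite lt_neqAle eq_sym s1.
Unshelve. all: by end_near. Qed.

End conditions.

(** * The two-dimensional profile *)

Section profile.
Context {R : realType}.
Variables (phi : R -> R) (c : R).
Hypotheses (phi0 : phi 0 = 0) (phi_ge1 : forall s : R, 1 <= s -> phi s = s)
  (slope_le : forall s t : R, 0 < s -> s <= t -> phi t / t <= phi s / s)
  (c01 : 0 < c <= 1)
  (phi_exp : forall u v : R, 0 <= u -> u <= v -> c * (v - u) <= phi v - phi u)
  (phi_onto : forall y : R, 0 <= y -> exists2 x, 0 <= x & phi x = y)
  (phi_is_derive : forall s : R, 0 < s -> s != 1 ->
    exists2 l, 0 < l & is_derive s 1 phi l).
Implicit Types s t y : R.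

Definition slope s := phi s / s.

Lemma modulus_le s t : 0 <= s -> s <= t -> phi s <= phi t.
Proof.
move=> s0 st; have := phi_exp s0 st.
have c0 : 0 < c by case/andP: c01.
have : 0 <= c * (t - s) by rewrite mulr_ge0//; lra.
lra.
Qed.

Lemma modulus_ge0 s : 0 <= s -> 0 <= phi s.
Proof. by move=> s0; have := modulus_le (lexx 0) s0; rewrite phi0. Qed.

Lemma modulusE s : 0 <= s -> phi s = s * slope s.
Proof.
rewrite le_eqVlt => /predU1P[<-|s0]; first by rewrite mul0r.
by rewrite /slope mulrC divfK// gt_eqF.
Qed.

Lemma slope_ge1 s : 0 < s -> 1 <= slope s.
Proof.
move=> s0; have [s1|s1] := leP 1 s.
  by rewrite /slope phi_ge1// divff// gt_eqF.
by have := slope_le s0 (ltW s1); rewrite phi_ge1// divr1.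
Qed.

Lemma modulus_ge_id s : 0 <= s -> s <= phi s.
Proof.
move=> s0; rewrite modulusE//; move: s0.
rewrite le_eqVlt => /predU1P[<-|s0]; first by rewrite mul0r.
by have := slope_ge1 s0; nra.
Qed.

(** If s < t, then s slope(s) = phi(s) <= phi(t) = t slope(t) <= 2 s slope(t). Otherwise
    monotonicity of the slope suffices, since slopes are at least 1. *)
Lemma slope_le2 s t : 0 < s -> 0 < t -> t <= 2 * s -> slope s <= 2 * slope t.
Proof.
move=> s0 t0 ts; have [st|/ltW st] := leP s t.
  have h := modulus_le (ltW s0) st; have := slope_ge1 t0.
  rewrite !modulusE ?(ltW s0) ?(ltW t0)// in h; nra.
by have := slope_le t0 st; have := slope_ge1 t0; rewrite /slope; lra.
Qed.

(** Write phi(r) = r slope(r) and replace slope(t) by the larger slope(s). *)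
Lemma modulus_lipschitz s t : 0 < s -> s <= t -> phi t - phi s <= slope s * (t - s).
Proof.
move=> s0 st; have t0 : 0 < t by lra.
rewrite !modulusE ?(ltW s0) ?(ltW t0)//; have := slope_le s0 st.
by rewrite -/(slope s) -/(slope t); nra.
Qed.

(** * The profile for s, t >= 0 *)

Definition stretch_a s t := phi (s + t) - s.
(** [stretch_a] does not vanish at t = 0, so this second function brings the minimum down to 0
    there. It is linear in t below the diagonal t = s and equals 2 phi(t) above it; the factor 2
    keeps it above [stretch_a] on the axis s = 0. *)
Definition stretch_b s t := 2 * (t * slope (Num.max s t)).
Definition stretch s t := Num.min (stretch_a s t) (stretch_b s t).

Lemma stretch_bEr s t : 0 <= s -> s <= t -> stretch_b s t = 2 * phi t.
Proof. by move=> s0 st; rewrite /stretch_b max_r// modulusE//; lra. Qed.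

Lemma stretch_bEl s t : t <= s -> stretch_b s t = 2 * (t * slope s).
Proof. by move=> ts; rewrite /stretch_b max_l. Qed.

Lemma stretch_a_ge s t : 0 <= s -> 0 <= t -> t <= stretch_a s t.
Proof. by move=> s0 t0; rewrite /stretch_a; have := @modulus_ge_id (s + t); lra. Qed.

Lemma stretch_b_ge s t : 0 <= s -> 0 <= t -> 2 * t <= stretch_b s t.
Proof.
move=> s0; rewrite le_eqVlt => /predU1P[<-|t0]; first by rewrite /stretch_b mul0r.
have : 1 <= slope (Num.max s t) by apply: slope_ge1; rewrite lt_max t0 orbT.
by rewrite /stretch_b; nra.
Qed.

Lemma stretch_ge s t : 0 <= s -> 0 <= t -> t <= stretch s t.
Proof.
move=> s0 t0; have := stretch_a_ge s0 t0; have := stretch_b_ge s0 t0.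
by rewrite /stretch; case: (leP (stretch_a s t)); lra.
Qed.

Lemma stretch_le s t : stretch s t <= phi (s + t) - s.
Proof. by rewrite /stretch ge_min lexx. Qed.

Lemma stretch_s0 s : 0 <= s -> stretch s 0 = 0.
Proof.
move=> s0; have := stretch_ge s0 (lexx 0).
by rewrite /stretch /stretch_b mul0r mulr0 => h; apply/le_anti; rewrite h ge_min lexx orbT.
Qed.

Lemma stretch_0t t : 0 <= t -> stretch 0 t = phi t.
Proof.
move=> t0; rewrite /stretch stretch_bEr// /stretch_a add0r subr0 min_l//.
by have := modulus_ge0 t0; lra.
Qed.

Lemma stretch_far s t : 0 <= s -> 0 <= t -> 1 <= s + t -> stretch s t = t.
Proof.
move=> s0 t0 st; have := stretch_b_ge s0 t0; have := stretch_a_ge s0 t0.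
by rewrite /stretch /stretch_a phi_ge1//; case: (leP (s + t - s)); lra.
Qed.

Lemma stretch_b_le s t : 0 <= s -> 0 <= t -> 0 < s + t ->
  stretch_b s t <= 4 * (t * slope (s + t)).
Proof.
move=> s0 t0 st; rewrite /stretch_b.
have : slope (Num.max s t) <= 2 * slope (s + t).
  by apply: slope_le2 => //; case: (leP s); lra.
by nra.
Qed.

Lemma stretch_a_incr s t t' : 0 <= s -> 0 <= t -> t <= t' ->
  c * (t' - t) <= stretch_a s t' - stretch_a s t.
Proof.
move=> s0 t0 tt; rewrite /stretch_a.
have h : c * (s + t' - (s + t)) <= phi (s + t') - phi (s + t) by apply: phi_exp; lra.
by have e : s + t' - (s + t) = t' - t by [ring]; rewrite e in h; lra.
Qed.

(** The interval from t to t' is cut at s: above s the increments are those of 2 phi, below s the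
    function is linear with coefficient 2 slope(s) >= 2 >= c. *)
Lemma stretch_b_incr s t t' : 0 <= s -> 0 <= t -> t <= t' ->
  c * (t' - t) <= stretch_b s t' - stretch_b s t.
Proof.
have c1 := c01.
move=> s0 t0 tt.
have [st|ts] := leP s t.
  rewrite !stretch_bEr//; last lra.
  by have := phi_exp t0 tt; have := modulus_le t0 tt; lra.
have sp : 0 < s by lra.
have r1 := slope_ge1 sp.
have [st'|/ltW t's] := leP s t'; last first.
  rewrite !stretch_bEl ?(ltW ts)//.
  have : 0 <= (2 * slope s - c) * (t' - t) by rewrite mulr_ge0//; lra.
  lra.
rewrite stretch_bEr// stretch_bEl ?(ltW ts)//; have := phi_exp s0 st';
  have := modulus_le s0 st'.
have : 0 <= (2 * slope s - c) * (s - t) by rewrite mulr_ge0//; lra.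
by rewrite (modulusE s0); lra.
Qed.

Lemma stretch_incr s t t' : 0 <= s -> 0 <= t -> t <= t' ->
  c * (t' - t) <= stretch s t' - stretch s t.
Proof.
move=> s0 t0 tt; have := stretch_a_incr s0 t0 tt; have := stretch_b_incr s0 t0 tt.
by rewrite /stretch; case: (leP (stretch_a s t)); case: (leP (stretch_a s t')); lra.
Qed.

Let L := c^-1.

Let cL : c * L = 1. Proof. by rewrite mulfV// gt_eqF//; case/andP: c01. Qed.

Let L1 : 1 <= L. Proof. by rewrite invf_ge1; case/andP: c01. Qed.

(** Raising t by L |s' - s|, with L = 1/c, compensates any change of s. For [stretch_a] with s' >=
    s, phi gains at least c (1 + L)(s' - s) = (c + 1)(s' - s), which pays for the subtracted s' - s;
    with s' < s it suffices that s + t does not decrease. For [stretch_b] one distinguishes the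
    sides of the diagonal on which the two points lie. *)
Lemma stretch_cone s s' t : 0 <= s -> 0 <= s' -> 0 <= t ->
  stretch s t <= stretch s' (t + L * `|s' - s|).
Proof.
move=> s0 s'0 t0; have l1 := L1; have cl := cL; have c1 := c01.
have ha : stretch_a s t <= stretch_a s' (t + L * `|s' - s|).
  rewrite /stretch_a; case: ger0P => ss.
    have ld : 0 <= L * (s' - s) by rewrite mulr_ge0//; lra.
    have st0 : 0 <= s + t by lra.
    have st' : s + t <= s' + (t + L * (s' - s)) by lra.
    have := phi_exp st0 st'.
    rewrite (_ : c * _ = (c * L) * (s' - s) + c * (s' - s)); last by ring.
    have : 0 <= c * (s' - s) by rewrite mulr_ge0//; lra.
    by rewrite cl; lra.
  have ld : 0 <= (L - 1) * (s - s') by rewrite mulr_ge0//; lra.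
  have st0 : 0 <= s + t by lra.
  have st' : s + t <= s' + (t + L * - (s' - s)) by lra.
  by have := modulus_le st0 st'; lra.
have hb : stretch_b s t <= stretch_b s' (t + L * `|s' - s|).
  have d0 : 0 <= `|s' - s| by [].
  have t'0 : 0 <= t + L * `|s' - s| by nra.
  have [ss|ss] := leP s s'; last first.
    rewrite /stretch_b ltr0_norm ?subr_lt0// in t'0 *; set t' := t + _ in t'0 *.
    have tt' : t <= t' by rewrite /t'; nra.
    have [st|/ltW ts] := leP s t.
      rewrite max_r; [|lra]; rewrite -(modulusE t0) -(modulusE t'0).
      by have := modulus_le t0 tt'; lra.
    have [st'|/ltW t's] := leP s' t'.
      have [->|tn0] := eqVneq t 0; first by
        rewrite mul0r mulr0 mulr_ge0// mulr_ge0// divr_ge0// modulus_ge0.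
      have tp : 0 < t by rewrite lt_neqAle eq_sym tn0.
      rewrite -(modulusE t'0).
      have rst := slope_le tp ts; rewrite -/(slope s) -/(slope t) in rst.
      have : t * slope s <= t * slope t by rewrite ler_pM2l.
      by have := modulus_le t0 tt'; rewrite (modulusE t0); lra.
    have [s'00|s'n0] := eqVneq s' 0.
      have -> : t' = 0 by lra.
      by have -> : t = 0 by [lra]; rewrite !mul0r.
    have sp : 0 < s' by rewrite lt_neqAle eq_sym s'n0.
    have := slope_le sp (ltW ss); have := slope_ge1 sp.
    have := @slope_ge1 s; rewrite -/(slope s) -/(slope s'); nra.
  rewrite ger0_norm ?subr_ge0// in t'0 *; set t' := t + _ in t'0 *.
  have tt' : t <= t' by rewrite /t'; nra.
  have [st|/ltW ts] := leP s t.
    rewrite !stretch_bEr//; last by rewrite /t'; nra.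
    by have := modulus_le t0 tt'; lra.
  have [st'|/ltW t's] := leP s' t'.
    rewrite stretch_bEl// stretch_bEr//.
    have : s * slope s <= phi t' by rewrite -(modulusE s0); apply: modulus_le; lra.
    have := modulus_ge0 t'0.
    have : 0 <= slope s by rewrite /slope divr_ge0// modulus_ge0.
    by nra.
  rewrite !stretch_bEl//.
  have [s00|sn0] := eqVneq s 0.
    have -> : t = 0 by lra.
    have : 0 <= slope s' by rewrite /slope divr_ge0// modulus_ge0.
    by rewrite mul0r mulr0 => ?; rewrite mulr_ge0// mulr_ge0//; lra.
  have sp : 0 < s by rewrite lt_neqAle eq_sym sn0.
  have s'p : 0 < s' by lra.
  have h : phi s <= phi s' by exact: modulus_le.
  (* Both points lie below the diagonal, where [stretch_b] is 2 (t/s) phi(s). The ratio t/s does not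
     decrease, because t' s - t s' = (L s - t)(s' - s) and t <= s <= L s. *)
  have e : t * s' <= t' * s.
    have ls : 0 <= (L - 1) * s by rewrite mulr_ge0//; lra.
    have : 0 <= (L * s - t) * (s' - s) by rewrite mulr_ge0//; lra.
    by rewrite /t'; lra.
  rewrite ler_pM2l// /slope !mulrA ler_pdivrMr// mulrAC ler_pdivlMr//.
  have : t * s' * phi s <= t' * s * phi s'.
    by apply: ler_pM => //; [rewrite mulr_ge0|exact: modulus_ge0].
  lra.
by rewrite /stretch le_min !ge_min ha hb orbT.
Qed.

Lemma modulus_dist_le u v : 0 < u -> 0 < v ->
  `|phi u - phi v| <= slope (Num.min u v) * `|u - v|.
Proof.
move=> u0 v0; have [uv|/ltW vu] := leP u v.
  rewrite distrC (distrC u) !ger0_norm ?subr_ge0//; first exact: modulus_lipschitz.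
  exact: modulus_le (ltW u0) uv.
rewrite !ger0_norm ?subr_ge0//; first exact: modulus_lipschitz.
exact: modulus_le (ltW v0) vu.
Qed.

Lemma stretch_a_dist s s' t t' : 0 <= s -> 0 <= s' -> 0 <= t -> 0 <= t' ->
  0 < s + t -> 0 < s' + t' ->
  `|stretch_a s t - stretch_a s' t'| <=
    2 * slope (Num.min (s + t) (s' + t')) * (`|s - s'| + `|t - t'|).
Proof.
move=> s0 s'0 t0 t'0 st st'.
have m0 : 0 < Num.min (s + t) (s' + t') by rewrite lt_min st.
have r1 := slope_ge1 m0; set r := slope _ in r1 *.
have -> : stretch_a s t - stretch_a s' t' = (phi (s + t) - phi (s' + t')) - (s - s').
  by rewrite /stretch_a; ring.
apply: le_trans (ler_normB _ _) _.
have := modulus_dist_le st st'; rewrite -/r.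
have : `|s + t - (s' + t')| <= `|s - s'| + `|t - t'|.
  have -> : s + t - (s' + t') = (s - s') + (t - t') by ring.
  exact: ler_normD.
set d := `|s + t - _|; have : 0 <= `|s - s'| by []; have : 0 <= `|t - t'| by [].
move=> ? ? dd h.
have : 0 <= (r - 1) * (`|s - s'| + `|t - t'|) by rewrite mulr_ge0//; lra.
have : 0 <= r * (`|s - s'| + `|t - t'| - d) by rewrite mulr_ge0//; lra.
lra.
Qed.

(** With m <= m' the two maxima, t slope(m) - t' slope(m') splits as (t - t') slope(m') + t
    (slope(m) - slope(m')). The last term is at most (m' - m) slope(m') because t <= m and phi(m) <=
    phi(m'). Finally m' is at least half of s' + t', so [slope_le2] gives slope(m') <= 2 slope(min),
    whence 8 = 2 * 2 * 2. *)
Lemma stretch_b_dist s s' t t' : 0 <= s -> 0 <= s' -> 0 <= t -> 0 <= t' ->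
  0 < s + t -> 0 < s' + t' ->
  `|stretch_b s t - stretch_b s' t'| <=
    8 * slope (Num.min (s + t) (s' + t')) * (`|s - s'| + `|t - t'|).
Proof.
wlog mm : s s' t t' / Num.max s t <= Num.max s' t'.
  move=> h s0 s'0 t0 t'0 st st'.
  have [|/ltW] := leP (Num.max s t) (Num.max s' t'); first by move/h; exact.
  by move/h; rewrite minC distrC (distrC s) (distrC t); exact.
move=> s0 s'0 t0 t'0 st st'.
have m0 : 0 < Num.min (s + t) (s' + t') by rewrite lt_min st.
rewrite /stretch_b; set m := Num.max s t in mm *; set m' := Num.max s' t' in mm *.
have sm : s <= m by rewrite le_max lexx.
have tm : t <= m by rewrite le_max lexx orbT.
have sm' : s' <= m' by rewrite le_max lexx.
have tm' : t' <= m' by rewrite le_max lexx orbT.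
have mp : 0 < m by lra.
have mp' : 0 < m' by lra.
have hr : slope m' <= 2 * slope (Num.min (s + t) (s' + t')).
  by apply: slope_le2 => //; rewrite ge_min; apply/orP; right; lra.
have r1 := slope_ge1 m0; set r := slope (Num.min _ _) in r1 hr *.
have rm := slope_le mp mm; rewrite -/(slope m) -/(slope m') in rm.
have r1' := slope_ge1 mp'.
have hm : m' - m <= `|s - s'| + `|t - t'|.
  have := ler_norm (s' - s); have := ler_norm (t' - t).
  have := normr_ge0 (s' - s); have := normr_ge0 (t' - t).
  by rewrite (distrC s) (distrC t) /m' /Num.max; case: ifP; lra.
have h1 : t * (slope m - slope m') <= (m' - m) * slope m'.
  have : 0 <= (m - t) * (slope m - slope m') by rewrite mulr_ge0//; lra.
  by have := modulus_le (ltW mp) mm; rewrite !modulusE ?(ltW mp) ?(ltW mp')//; lra.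
have -> : 2 * (t * slope m) - 2 * (t' * slope m') =
    2 * ((t - t') * slope m' + t * (slope m - slope m')) by ring.
rewrite normrM ger0_norm//.
have := ler_normD ((t - t') * slope m') (t * (slope m - slope m')).
rewrite normrM (@ger0_norm _ (slope m')); last lra.
rewrite (@ger0_norm _ (t * _)); last by rewrite mulr_ge0//; lra.
have : 0 <= `|s - s'| by []; have : 0 <= `|t - t'| by [].
move: (`|s - s'|) (`|t - t'|) hm => A B hm A0 B0.
have : 0 <= (A + B - (m' - m)) * slope m' by rewrite mulr_ge0//; lra.
have : 0 <= (A + B) * (2 * r - slope m') by rewrite mulr_ge0//; lra.
have : 0 <= A * slope m' by rewrite mulr_ge0//; lra.
lra.
Qed.

Lemma stretch_dist s s' t t' : 0 <= s -> 0 <= s' -> 0 <= t -> 0 <= t' ->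
  0 < s + t -> 0 < s' + t' ->
  `|stretch s t - stretch s' t'| <=
    8 * slope (Num.min (s + t) (s' + t')) * (`|s - s'| + `|t - t'|).
Proof.
move=> s0 s'0 t0 t'0 st st'.
have := stretch_a_dist s0 s'0 t0 t'0 st st'; have := stretch_b_dist s0 s'0 t0 t'0 st st'.
have m0 : 0 < Num.min (s + t) (s' + t') by rewrite lt_min st.
have r1 := slope_ge1 m0; set r := slope (Num.min _ _) in r1 *.
have : 0 <= `|s - s'| + `|t - t'| by rewrite addr_ge0.
set d := _ + _ => d0; rewrite !ler_norml => /andP[b1 b2] /andP[a1 a2].
have rd : 0 <= r * d by rewrite mulr_ge0//; lra.
by rewrite /stretch; case: (leP (stretch_a s t)); case: (leP (stretch_a s' t')) => h1 h2;
  apply/andP; split; lra.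
Qed.

(** * The inverse profile *)

Definition shrink s y := xget 0 [set t | 0 <= t /\ stretch s t = y].

(** Both functions in the minimum take the value y, at x1 - s (possibly negative) and at t2. Since
    both increase, at the larger of these two points one function equals y and the other is at least
    y. *)
Lemma shrink_spec s y : 0 <= s -> 0 <= y -> 0 <= shrink s y /\ stretch s (shrink s y) = y.
Proof.
move=> s0 y0.
suff : exists t, [set t | 0 <= t /\ stretch s t = y] t.
  by move=> /(@xgetPex _ 0)[].
have [x1 x10 x1E] := phi_onto (addr_ge0 y0 s0).
have [t2 t20 t2E] : exists2 t, 0 <= t & stretch_b s t = y.
  (* The value of [stretch_b] on the diagonal t = s is 2 phi(s). Below it the linear branch is
     inverted explicitly, above it the equation is 2 phi(t) = y. *)
  have [ys|/ltW sy] := leP y (2 * phi s).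
    have [s00|sn0] := eqVneq s 0.
      exists 0 => //; rewrite /stretch_b mul0r mulr0.
      by apply/le_anti; rewrite y0/=; move: ys; rewrite s00 phi0 mulr0.
    have sp : 0 < s by rewrite lt_neqAle eq_sym sn0.
    have rp := slope_ge1 sp.
    have r0 : slope s != 0 by lra.
    exists (y / (2 * slope s)); first by rewrite divr_ge0//; lra.
    rewrite stretch_bEl; first by field.
    by rewrite ler_pdivrMr; [rewrite modulusE// in ys; lra|lra].
  have y20 : 0 <= y / 2 by lra.
  have [t t0 tE] := phi_onto y20.
  exists t => //; rewrite stretch_bEr//; first by rewrite tE; field.
  rewrite leNgt; apply/negP => ts.
  have c1 := c01; have := phi_exp t0 (ltW ts); rewrite tE.
  have : 0 < c * (s - t) by rewrite mulr_gt0//; lra.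
  lra.
have [t12|/ltW t21] := leP (x1 - s) t2.
  exists t2; split => //; rewrite /stretch t2E min_r// /stretch_a.
  have h : x1 <= s + t2 by lra.
  by have := modulus_le x10 h; rewrite x1E; lra.
have t10 : 0 <= x1 - s by lra.
exists (x1 - s); split => //; have e : stretch_a s (x1 - s) = y.
  by rewrite /stretch_a (_ : s + (x1 - s) = x1) ?x1E ?addrK//; ring.
rewrite /stretch e min_l//.
have c1 := c01.
have : 0 <= c * (x1 - s - t2) by rewrite mulr_ge0//; lra.
by have := stretch_b_incr s0 t20 t21; rewrite t2E; lra.
Qed.

Lemma shrink_ge0 s y : 0 <= s -> 0 <= y -> 0 <= shrink s y.
Proof. by move=> s0 y0; case: (shrink_spec s0 y0). Qed.

Lemma shrinkK s y : 0 <= s -> 0 <= y -> stretch s (shrink s y) = y.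
Proof. by move=> s0 y0; case: (shrink_spec s0 y0). Qed.

Lemma stretch_inj s t t' : 0 <= s -> 0 <= t -> 0 <= t' ->
  stretch s t = stretch s t' -> t = t'.
Proof.
move=> s0; have c1 := c01; wlog tt : t t' / t < t'.
  move=> h t0 t'0 e; have [tt|tt|//] := ltgtP t t'; first exact: h.
  exact/esym/h.
move=> t0 t'0 e; have := stretch_incr s0 t0 (ltW tt).
have : 0 < c * (t' - t) by rewrite mulr_gt0//; lra.
by rewrite e; lra.
Qed.

Lemma stretchK s t : 0 <= s -> 0 <= t -> shrink s (stretch s t) = t.
Proof.
move=> s0 t0; have u0 : 0 <= stretch s t by apply: le_trans (stretch_ge s0 t0).
by apply: (@stretch_inj s); rewrite ?shrink_ge0 ?shrinkK.
Qed.

Lemma shrink_le s y : 0 <= s -> 0 <= y -> shrink s y <= y.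
Proof. by move=> s0 y0; have := stretch_ge s0 (shrink_ge0 s0 y0); rewrite shrinkK. Qed.

(** A change of s moves the root by at most L |s - s'| by [stretch_cone]; a change of y is then
    divided by the expansion constant c = 1/L. *)
Lemma shrink_dist s s' y y' : 0 <= s -> 0 <= s' -> 0 <= y -> 0 <= y' ->
  `|shrink s y - shrink s' y'| <= L * (`|s - s'| + `|y - y'|).
Proof.
have l1 := L1; have cl := cL; have c1 := c01.
have aux s1 s2 y1 y2 : 0 <= s1 -> 0 <= s2 -> 0 <= y1 -> 0 <= y2 ->
    shrink s2 y2 - shrink s1 y1 <= L * (`|s2 - s1| + `|y2 - y1|).
  move=> s10 s20 y10 y20.
  have t1 := shrink_ge0 s10 y10.
  have n1 : 0 <= `|s2 - s1| by []; have n2 : 0 <= `|y2 - y1| by [].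
  have p1 : 0 <= L * `|s2 - s1| by rewrite mulr_ge0//; lra.
  have p2 : 0 <= L * `|y2 - y1| by rewrite mulr_ge0//; lra.
  have [|/ltW h] := leP (shrink s2 y2) (shrink s1 y1 + L * `|s2 - s1|); first by lra.
  have := stretch_cone s10 s20 t1; rewrite shrinkK// => h1.
  have := @stretch_incr s2 _ _ s20 _ h; rewrite shrinkK// => h2.
  have : c * (shrink s2 y2 - (shrink s1 y1 + L * `|s2 - s1|)) <= `|y2 - y1|.
    by have := ler_norm (y2 - y1); have := h2 (addr_ge0 t1 p1); lra.
  move=> /(ler_wpM2l (ltW (lt_le_trans ltr01 l1))).
  by rewrite mulrA (mulrC L c) cl; lra.
move=> s0 s'0 y0 y'0; rewrite ler_norml; apply/andP; split; last exact: aux.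
by have := aux _ _ _ _ s0 s'0 y0 y'0; rewrite (distrC s') (distrC y'); lra.
Qed.

(** * Gluing the profile and its inverse along t = 0 *)

Definition glued s t := if 0 <= t then stretch s t else - shrink s (- t).

(** The reflection t |-> - t exchanges the half-lines carrying [stretch] and [shrink], which are
    mutually inverse. The value t = 0 is separate: its reflection falls again into the branch of
    [stretch]. *)
Lemma gluedK s t : 0 <= s -> glued s (- glued s (- t)) = t.
Proof.
move=> s0; rewrite {2}/glued oppr_ge0 opprK; case: leP => t0.
  have [->|tn0] := eqVneq t 0.
    by rewrite oppr0 stretch_s0// oppr0 /glued lexx stretch_s0.
  have mt0 : 0 <= - t by lra.
  have := stretch_ge s0 mt0.
  rewrite /glued oppr_ge0 => h; rewrite ifF.
    by rewrite opprK stretchK// opprK.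
  by apply/negbTE; rewrite -ltNge; apply: lt_le_trans h; rewrite oppr_gt0 lt_neqAle tn0.
by rewrite opprK /glued shrink_ge0 ?shrinkK// ltW.
Qed.

Lemma glued0 s : 0 <= s -> glued s 0 = 0.
Proof. by move=> s0; rewrite /glued lexx stretch_s0. Qed.

Lemma glued_0t t : 0 <= t -> glued 0 t = phi t.
Proof. by move=> t0; rewrite /glued t0 stretch_0t. Qed.

Lemma glued_far s t : 0 <= s -> 1 <= s + `|t| -> glued s t = t.
Proof.
move=> s0; rewrite /glued; case: (leP 0 t) => t0.
  by rewrite ger0_norm// => st; rewrite stretch_far.
rewrite ltr0_norm// => st.
have mt0 : 0 <= - t by lra.
by rewrite -[in - t](stretch_far s0 mt0 st) stretchK// opprK.
Qed.

(** This is the upper bound for the optimal modulus at the origin. Above it is built into the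
    minimum; below, [shrink] does not exceed the identity, and phi does. *)
Lemma glued_le s t : 0 <= s -> s + `|glued s t| <= phi (s + `|t|).
Proof.
move=> s0; rewrite /glued; case: (leP 0 t) => t0.
  rewrite !ger0_norm//; last exact: le_trans (stretch_ge s0 t0).
  by have := stretch_le s t; lra.
have mt0 : 0 <= - t by lra.
rewrite (@ltr0_norm _ t)// normrN ger0_norm ?shrink_ge0//.
by have := shrink_le s0 mt0; have := @modulus_ge_id (s - t); lra.
Qed.

(** Heights of equal sign fall under [stretch_dist] or [shrink_dist]. For t' < 0 <= t both values
    are compared with 0: [stretch s t] is at most 4 t slope(s + t), [shrink] at most - t', and |t -
    t'| = t + |t'|. *)
Let glued_dist_min s s' t t' : 0 <= s -> 0 <= s' ->
  0 < s + `|t| -> 0 < s' + `|t'| ->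
  `|glued s t - glued s' t'| <=
    (8 + L) * slope (Num.min (s + `|t|) (s' + `|t'|)) * (`|s - s'| + `|t - t'|).
Proof.
wlog tt : s s' t t' / t' <= t.
  move=> h s0 s'0 st st'.
  have [|/ltW] := leP t' t => tt; first exact: h.
  by rewrite minC distrC (distrC s) (distrC t); exact: h.
move=> s0 s'0 st st'.
have m0 : 0 < Num.min (s + `|t|) (s' + `|t'|) by rewrite lt_min st.
have r1 := slope_ge1 m0; have l1 := L1.
have mst : Num.min (s + `|t|) (s' + `|t'|) <= s + `|t| by rewrite ge_min lexx.
have := slope_le m0 mst; rewrite -/(slope _) -/(slope (Num.min _ _)).
rewrite /glued.
case: (leP 0 t) => t0; case: (leP 0 t') => t'0.
- move=> _; have h := stretch_dist s0 s'0 t0 t'0.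
  rewrite (ger0_norm t0) (ger0_norm t'0) in st st' m0 r1 *.
  apply: le_trans (h st st') _; rewrite ler_wpM2r ?addr_ge0//.
  rewrite ler_wpM2r//; lra.
- have mt0 : 0 <= - t' by lra.
  rewrite (ger0_norm t0) in st m0 r1 *; have h1 := stretch_b_le s0 t0 st.
  have h2 := shrink_le s'0 mt0.
  have h3 := shrink_ge0 s'0 mt0.
  have h4 : stretch s t <= stretch_b s t by rewrite /stretch ge_min lexx orbT.
  have h5 := stretch_ge s0 t0.
  rewrite opprK (@ger0_norm _ (stretch s t + _)); last lra.
  rewrite (@ger0_norm _ (t - t')); last lra.
  move: (Num.min _ _) (`|s - s'|) (normr_ge0 (s - s')) r1 => m A A0 r1 h6.
  have : 0 <= t * (slope m - slope (s + t)) by rewrite mulr_ge0//; lra.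
  have : 0 <= ((8 + L) * slope m - (4 * slope m + 1)) * (A + (t - t')).
    rewrite mulr_ge0//; last lra.
    have : 0 <= L * slope m by rewrite mulr_ge0//; lra.
    lra.
  have : 0 <= (4 * slope m + 1) * A by rewrite mulr_ge0//; lra.
  have : 0 <= slope m * - t' by rewrite mulr_ge0//; lra.
  lra.
- lra.
- have mt0 : 0 <= - t by lra.
  have mt'0 : 0 <= - t' by lra.
  have := shrink_dist s0 s'0 mt0 mt'0.
  have distN (a b : R) : `|- a - - b| = `|a - b| by rewrite -opprD normrN.
  rewrite !distN.
  move: (Num.min _ _) r1 => m r1 h1 _.
  have : 0 <= ((8 + L) * slope m - L) * (`|s - s'| + `|t - t'|).
    apply: mulr_ge0; last exact: addr_ge0.
    have : 0 <= (8 + L) * (slope m - 1) by rewrite mulr_ge0//; lra.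
    lra.
  lra.
Qed.

(* When one of the two norms is more than twice the other, the distance is comparable
   to the larger norm and the bound follows from [glued_le]. *)
Lemma glued_dist s s' t t' : 0 <= s -> 0 <= s' -> 0 < s + `|t| ->
  `|glued s t - glued s' t'| <=
    2 * (8 + L) * slope (s + `|t|) * (`|s - s'| + `|t - t'|).
Proof.
move=> s0 s'0 st.
have l1 := L1; have r1 := slope_ge1 st.
have d0 : 0 <= `|s - s'| + `|t - t'| by rewrite addr_ge0.
have t'n : 0 <= `|t'| by [].
have [st'|st'] := ltP (s + `|t|) (2 * (s' + `|t'|)).
  have st0 : 0 < s' + `|t'| by lra.
  apply: (le_trans (glued_dist_min s0 s'0 st st0)).
  have h2 : slope (Num.min (s + `|t|) (s' + `|t'|)) <= 2 * slope (s + `|t|).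
    apply: slope_le2 => //; first by rewrite lt_min st.
    by case: (leP (s + `|t|) (s' + `|t'|)); lra.
  rewrite ler_wpM2r//.
  have : 0 <= (8 + L) * (2 * slope (s + `|t|)
      - slope (Num.min (s + `|t|) (s' + `|t'|))) by rewrite mulr_ge0//; lra.
  lra.
have f1 := glued_le t s0; have f2 := glued_le t' s'0.
have f3 := @modulus_le (s' + `|t'|) (s + `|t|).
have : phi (s' + `|t'|) <= phi (s + `|t|) by apply: f3; lra.
have h := ler_normB (glued s t) (glued s' t').
have dd : s + `|t| <= 2 * (`|s - s'| + `|t - t'|).
  have := ler_norm (s - s'); have := ler_normD t' (t - t').
  by rewrite addrC subrK; lra.
rewrite (@modulusE (s + `|t|)) in f1 *; last lra.
have : 0 <= slope (s + `|t|) * (2 * (`|s - s'| + `|t - t'|) - (s + `|t|)).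
  by rewrite mulr_ge0//; lra.
have : 0 <= (2 * (8 + L) - 4) * (slope (s + `|t|) * (`|s - s'| + `|t - t'|)).
  by rewrite mulr_ge0//; [lra|rewrite mulr_ge0//; lra].
lra.
Qed.

(** * Partial derivatives of the glued profile *)

Let near_dist (x e : R) : 0 < e -> \forall y \near x, `|x - y| < e.
Proof. by move=> e0; exact: nbhsx_ballx. Qed.

Let near_pos (x : R) : 0 < x -> \forall y \near x, 0 < y.
Proof. by move=> x0; exact: lt_nbhsr. Qed.

(** Where the two functions differ, the strict order between them persists nearby, so the minimum is
    locally one of two explicit formulas. *)
Let gap_near s t : 0 < s -> 0 < t -> stretch_a s t != stretch_b s t ->
  exists2 e, 0 < e & forall s' t', 0 < s' -> 0 <= t' ->
    `|s - s'| + `|t - t'| < e ->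
    (stretch_a s' t' < stretch_b s' t') = (stretch_a s t < stretch_b s t) /\
    (stretch_b s' t' < stretch_a s' t') = (stretch_b s t < stretch_a s t).
Proof.
move=> s0 t0 ab.
have st : 0 < s + t by lra.
pose r := slope ((s + t) / 2).
have st2 : 0 < (s + t) / 2 by lra.
have r1 : 1 <= r by exact: slope_ge1.
pose g := `|stretch_a s t - stretch_b s t|.
have g0 : 0 < g by rewrite normr_gt0 subr_eq0.
(* The first bound keeps s' + t' above (s + t)/2, so the Lipschitz constants of the two functions
   are at most 2 r and 8 r. The second makes their total change, at most 10 r d, smaller than the
   gap g. *)
exists (Num.min ((s + t) / 2) (g / (20 * r))).
  by rewrite lt_min st2/= divr_gt0// mulr_gt0//; lra.
move=> s' t' s'0 t'0; rewrite lt_min => /andP[d1 d2].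
have st' : 0 < s' + t' by lra.
have hmin : (s + t) / 2 <= Num.min (s + t) (s' + t').
  have := ler_norm (s - s'); have := ler_norm (t - t').
  by rewrite le_min; move=> *; apply/andP; split; lra.
have hr : slope (Num.min (s + t) (s' + t')) <= r := slope_le st2 hmin.
have ha := stretch_a_dist (ltW s0) (ltW s'0) (ltW t0) t'0 st st'.
have hb := stretch_b_dist (ltW s0) (ltW s'0) (ltW t0) t'0 st st'.
set d := `|s - s'| + `|t - t'| in d1 d2 ha hb *.
have d0 : 0 <= d by rewrite addr_ge0.
have hd : 10 * (slope (Num.min (s + t) (s' + t')) * d) < g.
  move: d2; rewrite ltr_pdivlMr; last lra.
  have : 0 <= (r - slope (Num.min (s + t) (s' + t'))) * d by rewrite mulr_ge0//; lra.
  have : 0 <= r * d by rewrite mulr_ge0//; lra.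
  lra.
move: ha hb; rewrite !ler_norml => /andP[a1 a2] /andP[b1 b2].
move: hd; rewrite /g.
have [h|h|h] := ltgtP (stretch_a s t) (stretch_b s t); last by rewrite h eqxx in ab.
- rewrite ltr0_norm ?subr_lt0// => hd.
  by split; [apply/idP|apply/negbTE; rewrite -leNgt]; lra.
- rewrite gtr0_norm ?subr_gt0// => hd.
  by split; [apply/negbTE; rewrite -leNgt|apply/idP]; lra.
Qed.

(** If t >= s, then phi(s + t) <= phi(t) + s slope(t) <= 2 phi(t), so [stretch_a] is below 2 phi(t).
    If s >= 1, then [stretch_a] is t while [stretch_b] is at least 2 t. Hence wherever [stretch_b]
    is the minimum it has its linear form, with slope differentiable at s. *)
Let gap_lt s t : 0 < s -> 0 < t -> stretch_b s t < stretch_a s t -> t < s /\ s < 1.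
Proof.
move=> s0 t0 ba; split.
  rewrite ltNge; apply/negP => st; move: ba; rewrite stretch_bEr// ?(ltW s0)// /stretch_a.
  have := modulus_lipschitz t0 (_ : t <= s + t); rewrite lerDr (ltW s0) => /(_ isT).
  have : slope t * (s + t - t) <= slope t * t.
    by rewrite ler_wpM2l//; [have := slope_ge1 t0; lra|lra].
  by rewrite (@modulusE t) ?(ltW t0)//; lra.
rewrite ltNge; apply/negP => s1; move: ba; rewrite /stretch_a phi_ge1; last lra.
by have := stretch_b_ge (ltW s0) (ltW t0); lra.
Qed.

(* On a vertical line the two functions agree at one point t > 0 at most: for t >= s
   the first one is smaller, and for t < s the second one is linear in t with slope
   2 * slope s, which exceeds the increments of the first. *)
Let gap_uniq s t t' : 0 < s -> 0 < t -> 0 < t' ->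
  stretch_a s t = stretch_b s t -> stretch_a s t' = stretch_b s t' -> t = t'.
Proof.
wlog tt : t t' / t < t'.
  move=> h s0 t0 t'0 e e'; have [tt|tt|//] := ltgtP t t'; first exact: h.
  exact/esym/h.
move=> s0 t0 t'0 e e'.
have ltts r : 0 < r -> stretch_a s r = stretch_b s r -> r < s.
  move=> r0 er; rewrite ltNge; apply/negP => sr.
  move: er; rewrite stretch_bEr// ?(ltW s0)// /stretch_a.
  have := modulus_lipschitz r0 (_ : r <= s + r); rewrite lerDr (ltW s0) => /(_ isT).
  have : slope r * (s + r - r) <= slope r * r.
    by rewrite ler_wpM2l//; [have := slope_ge1 r0; lra|lra].
  by rewrite (@modulusE r) ?(ltW r0)//; lra.
have ts := ltts _ t0 e; have t's := ltts _ t'0 e'.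
move: e e'; rewrite !stretch_bEl ?ltW// /stretch_a => e e'.
have r1 := slope_ge1 s0.
have st : 0 < s + t by lra.
have := modulus_lipschitz st (_ : s + t <= s + t'); rewrite lerD2l (ltW tt) => /(_ isT).
have hst : s <= s + t by lra.
have : slope (s + t) <= slope s := slope_le s0 hst.
have : 0 < slope s * (t' - t) by rewrite mulr_gt0//; lra.
move=> h1 h2.
have : 0 <= (slope s - slope (s + t)) * (t' - t) by rewrite mulr_ge0//; lra.
lra.
Qed.

Let phi_derivable s : 0 < s -> s != 1 -> derivable phi s 1.
Proof. by move=> s0 s1; have [l _ []] := phi_is_derive s0 s1. Qed.

Let slope_derivable s : 0 < s -> s != 1 -> derivable slope s 1.
Proof.
move=> s0 s1; apply: derivableM; first exact: phi_derivable.
by apply: derivableV => //; rewrite gt_eqF.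
Qed.

Let phi_inv z := xget 0 [set x | 0 <= x /\ phi x = z].

Let phi_invK x : 0 <= x -> phi_inv (phi x) = x.
Proof.
move=> x0; have [|z0 e] := @xgetPex _ 0 [set z | 0 <= z /\ phi z = phi x].
  by exists x.
rewrite -/(phi_inv _) in z0 e; have c1 := c01.
have [h|h|//] := ltgtP (phi_inv (phi x)) x.
  by have := phi_exp z0 (ltW h); rewrite e subrr pmulr_rle0//; lra.
by have := phi_exp x0 (ltW h); rewrite e subrr pmulr_rle0//; lra.
Qed.

Let phi_inv_derivable x : 0 < x -> x != 1 -> derivable phi_inv (phi x) 1.
Proof.
move=> x0 x1; have [l l0 dl] := phi_is_derive x0 x1.
suff : is_derive (phi x) 1 phi_inv l^-1 by case.
apply: (@is_derive_inverse _ phi) => //; last by rewrite gt_eqF.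
  by near=> z; apply: phi_invK; apply: ltW; near: z; exact: near_pos.
near=> z; apply/differentiable_continuous/derivable1_diffP/phi_derivable.
  by near: z; exact: near_pos.
by near: z; apply: open_nbhs_nbhs; split => //; exact: open_neq.
Unshelve. all: by end_near. Qed.

Let shift_derivable (f : R -> R) (a x : R) : derivable f (a + x) 1 ->
  derivable (fun y => f (a + y)) x 1.
Proof.
move=> df; apply/derivable1_diffP; apply: (@differentiable_comp _ _ _ _ (fun y => a + y)).
  apply/derivable1_diffP.
  exact: (derivableD (@derivable_cst _ _ _ a x 1) (@derivable_id _ _ x 1)).
exact/derivable1_diffP.
Qed.

(** Near (s, t) the minimum is phi(s + t) - s or 2 t slope(s). The condition s + t != 1 avoids the
    possible kink of phi at 1. *)
Lemma stretch_derivable s t : 0 < s -> 0 < t -> s + t != 1 ->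
  stretch_a s t != stretch_b s t ->
  derivable (glued s) t 1 /\ derivable (glued^~ t) s 1.
Proof.
move=> s0 t0 st1 ab; have [e e0 he] := gap_near s0 t0 ab.
have st0 : 0 < s + t by lra.
have [lt|gt|eq] := ltgtP (stretch_a s t) (stretch_b s t); last by rewrite eq eqxx in ab.
  have hup s' t' : 0 < s' -> 0 < t' -> `|s - s'| + `|t - t'| < e ->
      phi (s' + t') - s' = glued s' t'.
    move=> s'0 t'0 /(he _ _ s'0 (ltW t'0))[+ _]; rewrite lt => h.
    by rewrite /glued (ltW t'0) /stretch min_l// ltW.
  split.
    apply: (@near_eq_derivable _ _ _ (fun t' => phi (s + t') - s)).
      near=> t'; apply: hup => //; first by near: t'; exact: near_pos.
      by rewrite subrr normr0 add0r; near: t'; exact: near_dist.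
    apply: derivableB; last exact: derivable_cst.
    by apply: (@shift_derivable phi); exact: phi_derivable.
  apply: (@near_eq_derivable _ _ _ (fun s' => phi (t + s') - s')).
    near=> s'; rewrite (addrC t); apply: hup => //; first by near: s'; exact: near_pos.
    by rewrite subrr normr0 addr0; near: s'; exact: near_dist.
  apply: derivableB; last exact: derivable_id.
  apply: (@shift_derivable phi).
  by apply: phi_derivable; rewrite addrC.
have [ts s1] := gap_lt s0 t0 gt.
have hup s' t' : 0 < s' -> 0 < t' -> t' < s' -> `|s - s'| + `|t - t'| < e ->
    2 * (t' * slope s') = glued s' t'.
  move=> s'0 t'0 ts' /(he _ _ s'0 (ltW t'0))[_]; rewrite gt => h.
  by rewrite /glued (ltW t'0) /stretch min_r ?(ltW h)// stretch_bEl// ltW.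
split.
  apply: (@near_eq_derivable _ _ _ (fun t' => 2 * (t' * slope s))).
    near=> t'; apply: hup => //; first by near: t'; exact: near_pos.
      by near: t'; exact: lt_nbhsl.
    by rewrite subrr normr0 add0r; near: t'; exact: near_dist.
  by apply: derivableM => //; exact: derivableM.
apply: (@near_eq_derivable _ _ _ (fun s' => 2 * (t * slope s'))).
  near=> s'; apply: hup => //; first by near: s'; exact: near_pos.
    by near: s'; exact: lt_nbhsr.
  by rewrite subrr normr0 addr0; near: s'; exact: near_dist.
apply: derivableM => //; apply: derivableM => //.
by apply: slope_derivable => //; rewrite lt_eqF.
Unshelve. all: by end_near. Qed.

(** As for [stretch], with the inverted formulas y / (2 slope(s)) and phi^-1(s + y) - s. In the
    second case phi maps s + [shrink s y] to s + y, so s + y != 1 keeps the argument of phi away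
    from 1. *)
Lemma shrink_derivable s y : 0 < s -> 0 < y -> s + y != 1 ->
  stretch_a s (shrink s y) != stretch_b s (shrink s y) ->
  derivable (shrink s) y 1 /\ derivable (shrink^~ y) s 1.
Proof.
move=> s0 y0 sy1.
have [t0 tE] := shrink_spec (ltW s0) (ltW y0).
have {}t0 : 0 < shrink s y.
  rewrite lt_neqAle t0 andbT; apply/eqP => h.
  by move: tE; rewrite -h stretch_s0 ?(ltW s0)//; lra.
move=> ab; have [e e0 he] := gap_near s0 t0 ab.
have l1 := L1.
(* [shrink_dist] carries the neighbourhood of the pair formed by s and the root back to one of (s,
   y), at the cost of the factor 1 + L. *)
have he' s' y' : 0 < s' -> 0 < y' -> `|s - s'| + `|y - y'| < e / (1 + L) ->
    `|s - s'| + `|shrink s y - shrink s' y'| < e.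
  move=> s'0 y'0; rewrite ltr_pdivlMr; last lra.
  have := shrink_dist (ltW s0) (ltW s'0) (ltW y0) (ltW y'0).
  have := normr_ge0 (y - y'); lra.
have e'0 : 0 < e / (1 + L) by rewrite divr_gt0//; lra.
have [lt|gt|eq] := ltgtP (stretch_a s (shrink s y)) (stretch_b s (shrink s y)); last first.
- by rewrite eq eqxx in ab.
- have [ts s1] := gap_lt s0 t0 gt.
  have r1 := slope_ge1 s0.
  have hdn s' y' : 0 < s' -> 0 < y' -> shrink s' y' < s' ->
      `|s - s'| + `|y - y'| < e / (1 + L) ->
      y' / (2 * slope s') = shrink s' y'.
    move=> s'0 y'0 ts' /(he' _ _ s'0 y'0) h.
    have [t'0 t'E] := shrink_spec (ltW s'0) (ltW y'0).
    have [_] := he _ _ s'0 t'0 h; rewrite gt => {}h.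
    have r1' := slope_ge1 s'0.
    rewrite -[in LHS]t'E /stretch min_r ?(ltW h)// stretch_bEl ?(ltW ts')//.
    by field; lra.
  have hlt s' y' : 0 < s' -> 0 < y' -> `|s - s'| + `|y - y'| < (s - shrink s y) / (1 + L) ->
      shrink s' y' < s'.
    move=> s'0 y'0; rewrite ltr_pdivlMr; last lra.
    have := shrink_dist (ltW s0) (ltW s'0) (ltW y0) (ltW y'0).
    have := ler_norm (s - s').
    rewrite (distrC (shrink s y)); have := ler_norm (shrink s' y' - shrink s y).
    have := normr_ge0 (y - y'); lra.
  have f0 : 0 < (s - shrink s y) / (1 + L) by rewrite divr_gt0//; lra.
  split.
    apply: (@near_eq_derivable _ _ _ (fun y' => y' / (2 * slope s))).
      near=> y'; apply: hdn => //; first by near: y'; exact: near_pos.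
        apply: hlt => //; first by near: y'; exact: near_pos.
        by rewrite subrr normr0 add0r; near: y'; exact: near_dist.
      by rewrite subrr normr0 add0r; near: y'; exact: near_dist.
    by apply: derivableM.
  apply: (@near_eq_derivable _ _ _ (fun s' => y / (2 * slope s'))).
    near=> s'; apply: hdn => //; first by near: s'; exact: near_pos.
      apply: hlt => //; first by near: s'; exact: near_pos.
      by rewrite subrr normr0 addr0; near: s'; exact: near_dist.
    by rewrite subrr normr0 addr0; near: s'; exact: near_dist.
  apply: derivableM => //; apply: derivableV; first by rewrite mulf_neq0//; lra.
  by apply: derivableM => //; apply: slope_derivable => //; rewrite lt_eqF.
have hdn s' y' : 0 < s' -> 0 < y' -> `|s - s'| + `|y - y'| < e / (1 + L) ->
    phi_inv (s' + y') - s' = shrink s' y'.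
  move=> s'0 y'0 /(he' _ _ s'0 y'0) h.
  have [t'0 t'E] := shrink_spec (ltW s'0) (ltW y'0).
  have [+ _] := he _ _ s'0 t'0 h; rewrite lt => {}h.
  rewrite -[in s' + y']t'E /stretch min_l ?(ltW h)// /stretch_a (addrC s') subrK.
  by rewrite phi_invK ?addr_ge0 ?(ltW s'0)// addrC addKr.
have xE : s + y = phi (s + shrink s y).
  by rewrite -[in LHS]tE /stretch min_l ?(ltW lt)// /stretch_a addrC subrK.
have x1 : s + shrink s y != 1.
  by apply: contra sy1 => /eqP e1; rewrite xE e1 phi_ge1.
have dinv : derivable phi_inv (s + y) 1.
  by rewrite xE; apply: phi_inv_derivable => //; rewrite addr_gt0.
split.
  apply: (@near_eq_derivable _ _ _ (fun y' => phi_inv (s + y') - s)).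
    near=> y'; apply: hdn => //; first by near: y'; exact: near_pos.
    by rewrite subrr normr0 add0r; near: y'; exact: near_dist.
  apply: derivableB; last exact: derivable_cst.
  exact: (@shift_derivable phi_inv).
apply: (@near_eq_derivable _ _ _ (fun s' => phi_inv (y + s') - s')).
  near=> s'; rewrite (addrC y); apply: hdn => //; first by near: s'; exact: near_pos.
  by rewrite subrr normr0 addr0; near: s'; exact: near_dist.
apply: derivableB; last exact: derivable_id.
by apply: (@shift_derivable phi_inv); rewrite addrC.
Unshelve. all: by end_near. Qed.

(** The exceptional heights are 0, the two solutions of s + |t| = 1, the crossing point of the two
    functions for t > 0, which is unique by [gap_uniq], and the height below 0 that [shrink] sends
    to that crossing. *)
Lemma glued_derivable s : 0 < s -> exists2 E : set R, finite_set E &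
  forall t, ~ E t -> derivable (glued s) t 1 /\ derivable (glued^~ t) s 1.
Proof.
move=> s0.
pose T := [set t | 0 < t /\ stretch_a s t = stretch_b s t].
pose T' := [set t | t < 0 /\ T (shrink s (- t))].
have fin_uniq (A : set R) : (forall x y, A x -> A y -> x = y) -> finite_set A.
  move=> h; have [->|/set0P[x Ax]] := eqVneq A set0; first exact: finite_set0.
  by apply: (sub_finite_set _ (finite_set1 x)) => y Ay; exact: h.
exists ([set 0; 1 - s; s - 1] `|` (T `|` T')).
  rewrite !finite_setU; split; first by split=> //; exact: finite_set1.
  split; apply: fin_uniq.
    by move=> x y [x0 ex] [y0 ey]; exact: gap_uniq ex ey.
  move=> x y [x0 [x1 ex]] [y0 [y1 ey]]; have := gap_uniq s0 x1 y1 ex ey.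
  move=> /(congr1 (stretch s)); rewrite !shrinkK ?(ltW s0)//; lra.
move=> t tE.
have tn0 : t != 0 by apply/eqP => e; apply: tE; left; left; left.
have [t0|t0] := ltP 0 t.
  apply: stretch_derivable => //.
    by apply/eqP => e; apply: tE; left; left; right => /=; lra.
  by apply/eqP => e; apply: tE; right; left.
have mt0 : 0 < - t by lra.
have st1 : s + - t != 1.
  by apply/eqP => e; apply: tE; left; right => /=; lra.
have ab : stretch_a s (shrink s (- t)) != stretch_b s (shrink s (- t)).
  apply/eqP => e; apply: tE; right; right; split; first by rewrite lt_neqAle tn0.
  split => //; have [+ dE] := shrink_spec (ltW s0) (ltW mt0).
  rewrite le_eqVlt => /predU1P[d0|//].
  by move: dE; rewrite -d0 stretch_s0 ?(ltW s0)//; lra.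
have [d1 d2] := shrink_derivable s0 mt0 st1 ab.
split.
  apply: (@near_eq_derivable _ _ _ (fun t' => - shrink s (- t'))).
    near=> t'; rewrite /glued ifF//; apply/negbTE; rewrite -ltNge.
    by near: t'; apply: lt_nbhsl; rewrite lt_neqAle tn0.
  apply: derivableN; apply/derivable1_diffP.
  by apply: differentiable_comp => //; exact/derivable1_diffP.
rewrite (_ : glued^~ t = (fun s' => - shrink s' (- t))); first exact: derivableN.
by apply/funext => s'; rewrite /glued ifF//; apply/negbTE; rewrite -ltNge lt_neqAle tn0.
Unshelve. all: by end_near. Qed.

End profile.

(** * Borel sets and Lebesgue measure on R^n *)

Section borel.
Context {R : realType} {n : nat}.
Implicit Types (U K : set 'rV[R]_n) (f : 'rV[R]_n -> R).

Lemma measurable_box (P : 'I_n -> set R) : (forall i, measurable (P i)) ->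
  measurable [set x : 'rV[R]_n | forall i, P i (x 0 i)].
Proof.
move=> mP.
have -> : [set x : 'rV[R]_n | forall i, P i (x 0 i)] =
    \bigcap_(i in [set: 'I_n]) ((fun x : 'rV[R]_n => x 0 i) @^-1` P i).
  by apply/seteqP; split=> x /= h i; [move=> _; exact: h|exact: (h i)].
apply: fin_bigcap_measurable; first exact: finite_finset.
by move=> i _; rewrite -[X in measurable X]setTI; exact: measurable_coord.
Qed.

(** The sigma-algebra is generated by the coordinates, so the open set is written as a countable
    union of boxes with rational centres and radii. *)
Lemma open_measurable_rV U : open U -> measurable U.
Proof.
move=> oU.
pose box (z : 'rV[rat]_n * rat) : set 'rV[R]_n :=
  [set x | forall i, ball (ratr (z.1 0 i) : R) (ratr z.2) (x 0 i)].
(* The second factor is everything or empty according to whether the box lies in U; this keeps the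
   union over a countable type. *)
have -> : U = \bigcup_z (box z `&` [set _ | box z `<=` U]).
  apply/seteqP; split => [x Ux|x [z _ [zx zU]]]; last exact: zU.
  have [e /= e0 eU] : nbhs_ball x U by apply/nbhs_ballP; move: oU; rewrite openE; exact.
  have e2 : 0 < e / 2 by rewrite divr_gt0.
  have [q] := rat_in_itvoo e2; rewrite in_itv/= => /andP[q0 qe].
  have hz i : exists z : rat, `|x 0 i - ratr z| < ratr q.
    have : x 0 i - ratr q < x 0 i + ratr q by lra.
    move=> /rat_in_itvoo[z]; rewrite in_itv/= => /andP[z1 z2]; exists z.
    by rewrite ltr_norml; apply/andP; split; lra.
  have [z hz'] := choice hz.
  exists (\row_i z i, q) => //; split; first by move=> i; rewrite /= mxE /ball/= distrC.
  move=> y hy; apply: eU; split => // i j; rewrite ord1.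
  have := hy j; rewrite /= mxE /ball/= => hj.
  have -> : x 0 j - y 0 j = (x 0 j - ratr (z j)) + (ratr (z j) - y 0 j) by ring.
  by apply: le_lt_trans (ler_normD _ _) _; have := hz' j; lra.
apply: countable_bigcupT_measurable => // z.
have [zU|zU] := pselect (box z `<=` U); last first.
  by rewrite (_ : _ `&` _ = set0)//; apply/seteqP; split => x // -[].
rewrite (_ : _ `&` _ = box z); last by apply/seteqP; split => x // -[].
apply: (@measurable_box (fun i => ball (ratr (z.1 0 i) : R) (ratr z.2))) => i.
by apply: open_measurable; exact: ball_open.
Qed.

Lemma continuous_measurable_rV f : continuous f -> measurable_fun [set: 'rV[R]_n] f.
Proof.
move=> /continuousP cf; apply: (measurability _ (RGenOpens.measurableE R)).
move=> _ [_ [a [b ->] <-]]; rewrite setTI; apply: open_measurable_rV.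
exact/cf/interval_open.
Qed.

Lemma compact_measurable_rV K : compact K -> measurable K.
Proof.
move=> cK; rewrite -[K]setCK; apply: measurableC; apply: open_measurable_rV.
apply: closed_openC; apply: compact_closed => //.
Qed.

Lemma coord_le_norm (x : 'rV[R]_n) i : `|x 0 i| <= `|x|.
Proof.
rewrite [leRHS]/Num.norm /= mx_normrE.
by apply/bigmax_geP; right => /=; exists (0, i).
Qed.

Lemma compact_bounded_rV K : compact K ->
  exists2 M, 0 < M & forall x, K x -> forall i, `|x 0 i| <= M.
Proof.
move=> /compact_bounded[M [_ hM]].
exists (`|M| + 1); first by rewrite ltr_wpDl.
move=> x Kx i; apply: le_trans (hM (`|M| + 1) _ x Kx); last first.
  by rewrite ltr_pwDr// ler_norm.
exact: coord_le_norm.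
Qed.

Lemma leb_cube_fin (M : R) : 0 <= M ->
  (leb R n [set x : 'rV[R]_n | forall i, x 0%R i \in `[(- M)%R, M]] < +oo)%E.
Proof.
move=> M0.
have := @leb_box R n (const_mx (- M)) (const_mx M).
rewrite (_ : [set v | _] = [set x : 'rV[R]_n | forall i, x 0%R i \in `[(- M)%R, M]]); last first.
  by apply/funext => x /=; apply: eq_forall => i; rewrite !mxE.
by move=> ->; [rewrite ltry|move=> i; rewrite !mxE; lra].
Qed.

Lemma leb_sigma_finite : sigma_finite [set: 'rV[R]_n] (leb R n).
Proof.
exists (fun k => [set x : 'rV[R]_n | forall i, x 0%R i \in `[(- k%:R)%R, k%:R]]).
  apply/esym/seteqP; split => // x _.
  have [k hk] : exists k : nat, forall i, `|x 0 i| <= k%:R.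
    exists (Num.bound (\sum_i `|x 0 i|)) => i.
    apply: le_trans (ltW (archi_boundP _)); last by rewrite sumr_ge0.
    by rewrite (bigD1 i)//= lerDl sumr_ge0.
  by exists k => // i; rewrite in_itv/= -ler_norml.
move=> k; split; last exact: leb_cube_fin.
by apply: (@measurable_box (fun _ => [set` `[(- k%:R)%R, k%:R]])) => i; exact: measurable_itv.
Qed.

End borel.

(** * Translation invariance of Lebesgue measure on R^n *)

Section translation.
Context {R : realType}.
Local Open Scope ereal_scope.

(** The image measure agrees with Lebesgue measure on half-open intervals, and uniqueness
    concludes. *)
Let translation_lebesgue (a : R) (A : set R) : measurable A ->
  lebesgue_measure ((fun t : measurableTypeR R => t + a)%R @^-1` A) =
  lebesgue_measure A.
Proof.
move=> mA.
have mf : measurable_fun [set: measurableTypeR R]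
    (fun t : measurableTypeR R => t + a : measurableTypeR R)%R.
  exact: measurable_funD.
pose mphi_mixin := isMeasurableFun.Build _ _ _ _ _ mf.
pose mphi_pack : {mfun _ >-> _} := HB.pack
  (fun t : measurableTypeR R => t + a : measurableTypeR R)%R mphi_mixin.
apply/esym; have := @lebesgue_measure_unique R (pushforward lebesgue_measure mphi_pack).
apply => // _ [[b c]] _ <-.
transitivity (lebesgue_measure (`](b - a)%R, (c - a)%R]%classic : set R)); last first.
  rewrite /= /pushforward/=; congr (lebesgue_measure _).
  by apply/seteqP; split => x /=; rewrite !in_itv/= ltrBlDr lerBrDr.
rewrite !lebesgue_measure_itv/= !lte_fin ltrD2r; case: ifPn => // _.
by rewrite -!EFinB; congr EFin; ring.
Qed.

Definition translate n (v x : 'rV[R]_n) : 'rV[R]_n := (x + v)%R.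

Lemma measurable_translation n (v : 'rV[R]_n) :
  measurable_fun [set: 'rV[R]_n] (translate v).
Proof.
apply: measurable_rVP => i; under eq_fun do rewrite mxE.
by apply: measurable_funD => //; exact: measurable_coord.
Qed.

HB.instance Definition _ n (v : 'rV[R]_n) := 
  isMeasurableFun.Build _ _ _ _ (translate v) (measurable_translation v).

(** Induction on the dimension through sections: the last coordinate is shifted inside each section
    by the one-dimensional case, and the induction hypothesis shifts the outer integral. *)
Lemma leb_translation n (v : 'rV[R]_n) (A : set 'rV[R]_n) : measurable A ->
  leb R n ((translate v) @^-1` A) = leb R n A.
Proof.
elim: n v A => [|n IH] v A mA.
  congr (leb R 0 _); apply/funext => x; rewrite /preimage/=; congr (A _).
  exact: (etrans (thinmx0 _) (esym (thinmx0 _))).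
pose v' : 'rV[R]_n := \row_i v 0%R (lift ord_max i).
rewrite /= /leb_step /pushforward/= /product_measure1.
set B := @snoc_rV R n @^-1` A.
have mB : measurable B.
  by rewrite -[B]setTI; exact: measurable_snoc_rV.
have -> : @snoc_rV R n @^-1` ((translate v) @^-1` A) =
    [set p | B (p.1 + v', p.2 + v 0 ord_max)%R].
  apply/funext => p; rewrite /preimage/=; congr (A _).
  apply/rowP => i; rewrite !mxE; case: unliftP => [j|] -> //=.
  by rewrite !mxE.
transitivity (\int[leb R n]_x ((lebesgue_measure \o xsection B) \o (translate v')) x).
  apply: eq_integral => x _ /=.
  rewrite -[RHS](translation_lebesgue (v 0%R ord_max)); last first.
    exact: measurable_xsection.
  congr (lebesgue_measure _).
transitivity (\int[pushforward (leb R n) (translate v')]_x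
    (lebesgue_measure \o xsection B) x).
  by rewrite [RHS]ge0_integral_pushforward//; exact: measurable_fun_xsection.
by apply: eq_measure_integral => C mC _; exact: IH.
Qed.

Lemma leb_integral_translation n (v : 'rV[R]_n) (f : 'rV[R]_n -> \bar R) :
  measurable_fun [set: 'rV[R]_n] f ->
  \int[leb R n]_x f (x + v)%R = \int[leb R n]_x f x.
Proof.
have ge0 (g : 'rV[R]_n -> \bar R) : measurable_fun [set: 'rV[R]_n] g ->
    (forall x, 0 <= g x) ->
    \int[leb R n]_x g (x + v)%R = \int[leb R n]_x g x.
  move=> mg g0.
  transitivity (\int[pushforward (leb R n) (translate v)]_x g x).
    by rewrite [RHS]ge0_integral_pushforward//.
  by apply: eq_measure_integral => C mC _; exact: leb_translation.
move=> mf; rewrite integralE [RHS]integralE; congr (_ - _).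
  rewrite -[RHS](ge0 _ (measurable_funepos mf))//.
  by apply: eq_integral => x _; rewrite -[RHS]/((f^\+ \o translate v) x) -funepos_comp.
rewrite -[RHS](ge0 _ (measurable_funeneg mf))//.
by apply: eq_integral => x _; rewrite -[RHS]/((f^\- \o translate v) x) -funeneg_comp.
Qed.

End translation.

(** * Difference quotients and weak derivatives *)

Definition cube (R : realType) n (M : R) : set 'rV[R]_n :=
  [set x | forall i, x 0 i \in `[- M, M]].

Section cube.
Context {R : realType} {n : nat}.
Implicit Types (f eta : 'rV[R]_n -> R) (M : R).

Lemma cube_compact M : compact (@cube R n M).
Proof.
apply: (@rV_compact _ _ (fun=> [set` `[- M, M]])) => _; exact: segment_compact.
Qed.

Lemma cubeP M x : cube M x <-> forall i : 'I_n, `|x 0 i| <= M.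
Proof. by split=> h i; have := h i; rewrite /= in_itv/= ler_norml. Qed.

Lemma measurable_cube M : measurable (@cube R n M).
Proof. by apply: compact_measurable_rV; exact: cube_compact. Qed.

Lemma compact_leb_fin (K : set 'rV[R]_n) : compact K -> (leb R n K < +oo)%E.
Proof.
move=> cK; have [M M0 KM] := compact_bounded_rV cK.
apply: le_lt_trans (@leb_cube_fin R n M (ltW M0)).
apply: le_measure; rewrite ?inE//; [exact: compact_measurable_rV|exact: measurable_cube|].
by move=> X KX i; rewrite in_itv/= -ler_norml; exact: KM.
Qed.

Lemma continuous_bounded_cube f M : continuous f ->
  exists2 C, 0 < C & forall x, cube M x -> `|f x| <= C.
Proof.
move=> cf.
have : compact (f @` cube M).
  by apply: continuous_compact; [exact: continuous_subspaceT|exact: cube_compact].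
move=> /compact_bounded[C [_ hC]]; exists (`|C| + 1); first by rewrite ltr_wpDl.
move=> x Mx; apply: (hC (`|C| + 1)); last by exists x.
by rewrite ltr_pwDr// ler_norm.
Qed.

Lemma integrable_cube_supp f C M : 0 <= M -> measurable_fun [set: 'rV[R]_n] f ->
  (forall x, `|f x| <= C) -> (forall x, ~ cube M x -> f x = 0) ->
  (leb R n).-integrable [set: 'rV[R]_n] (EFin \o f).
Proof.
move=> M0 mf fC f0.
have : (leb R n).-integrable (cube M) (EFin \o f).
  apply: measurable_bounded_integrable.
  - exact: measurable_cube.
  - exact: leb_cube_fin.
  - exact: measurable_funTS.
  - exists C; split; first exact: num_real.
    by move=> C' CC' x _; apply: le_trans (ltW CC').
move=> /(integrable_mkcond _ (measurable_cube M)).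
apply: eq_integrable => // x _; rewrite patchE; case: ifPn => //.
by rewrite notin_setE => /f0 /= ->.
Qed.

Lemma test_function_supp eta : test_function eta ->
  exists2 M, 0 < M & forall x, ~ cube M x -> eta x = 0.
Proof.
move=> [_ /compact_bounded_rV[M M0 hM]]; exists M => // x xM.
apply/eqP; apply: contrapT => /negP ex; apply: xM; apply/cubeP.
by apply: hM; exact: subset_closure.
Qed.

Lemma test_function_continuous eta : test_function eta -> continuous eta.
Proof. by move=> [/(_ [::])[]]. Qed.

Lemma test_function_partial_continuous eta i :
  test_function eta -> continuous (partial i eta).
Proof. by move=> [/(_ [:: i])[]]. Qed.

Let e (i : 'I_n) : 'rV[R]_n := delta_mx 0 i.

Lemma test_function_is_derive eta i x (s : R) : test_function eta ->
  is_derive s 1 (fun t => eta (x + t *: e i)) (partial i eta (x + s *: e i)).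
Proof.
move=> [/(_ [::])[_ +] _] => /(_ i (x + s *: e i)) /= d.
have E : (fun h : R => h^-1 *: (((fun t => eta (x + t *: e i)) \o shift s) (h *: 1)
      - eta (x + s *: e i))) =
    (fun h : R => h^-1 *: ((eta \o shift (x + s *: e i)) (h *: e i)
      - eta (x + s *: e i))).
  apply/funext => h /=; congr (_ *: (eta _ - _)).
  by rewrite [h *: 1]mulr1 scalerDl addrCA.
split; first by rewrite /derivable E.
by rewrite /derive E.
Qed.

Lemma test_function_lipschitz eta i : test_function eta ->
  exists2 C, 0 < C & forall x (a : R), 0 < a -> a <= 1 ->
    `|eta (x + a *: e i) - eta x| <= C * a.
Proof.
move=> teta; have [M M0 eta0] := test_function_supp teta.
(* With steps of length at most 1, either x is outside the cube of size M + 1 and both values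
   vanish, or the whole segment lies in the cube of size M + 2 and the mean value theorem
   applies. *)
have [C C0 hC] := continuous_bounded_cube (M + 2)
  (test_function_partial_continuous (i := i) teta).
exists C => // x a a0 a1.
have [xM|xM] := pselect (cube (M + 1) x); last first.
  have e1 : ~ cube M x.
    by move=> /cubeP h; apply: xM; apply/cubeP => j; have := h j; lra.
  have e2 : ~ cube M (x + a *: e i).
    move=> /cubeP h; apply: xM; apply/cubeP => j; have := h j; rewrite !mxE eqxx/=.
    case: (_ == _); rewrite ?mulr1 ?mulr0 ?addr0; last by lra.
    by rewrite !ler_norml; lra.
  by rewrite !eta0// subrr normr0 mulr_ge0// ltW.
have d t : t \in `]0, a[ -> is_derive t 1 (fun t => eta (x + t *: e i))
    (partial i eta (x + t *: e i)) by move=> _; exact: test_function_is_derive.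
have c : {within `[0, a], continuous (fun t => eta (x + t *: e i))}.
  apply: derivable_within_continuous => t _.
  by have [] := test_function_is_derive i x t teta.
have [t] := MVT a0 d c; rewrite in_itv/= => /andP[t0 ta].
rewrite scale0r addr0 subr0 => ->.
rewrite normrM (gtr0_norm a0) ler_pM2r//; apply: hC; apply/cubeP => j.
move/cubeP : xM => /(_ j); rewrite !mxE eqxx/=.
case: (_ == _); rewrite ?mulr1 ?mulr0 ?addr0; last by lra.
by rewrite !ler_norml; lra.
Qed.

Lemma test_function_cvg eta i x : test_function eta ->
  (fun k => (eta (x + harmonic k *: e i) - eta x) / harmonic k) @ \oo -->
    partial i eta x.
Proof.
move=> [/(_ [::])[_ +] _] => /(_ i x) /= d.
have h0 : harmonic @ \oo --> (0 : R)^'.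
  move=> P hP.
  have H : \forall k \near \oo, harmonic k != 0 :> R -> P (harmonic k).
    exact: (@cvg_harmonic R _ hP).
  suff : \forall k \near \oo, P (harmonic k) by [].
  by apply: filterS H => k; apply; rewrite gt_eqF ?harmonic_gt0.
rewrite (_ : (fun k => _) = (fun h : R => h^-1 *: ((eta \o shift x) (h *: e i)
      - eta x)) \o harmonic).
  exact: cvg_comp h0 d.
by apply/funext => k /=; rewrite mulrC (addrC x).
Qed.

End cube.

Section difference_quotients.
Context {R : realType} {n : nat}.
Variables (f G : 'rV[R]_n -> R) (i : 'I_n).

Let e : 'rV[R]_n := delta_mx 0 i.

(** The quotient is taken backwards so that, after a translation of the integral, the test function
    receives a forward quotient. The steps are 1/(k + 1). *)
Definition diff_quotient (k : nat) (x : 'rV[R]_n) : R :=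
  (f x - f (x - harmonic k *: e)) / harmonic k.

(* The limit superior is measurable; it is a limit almost everywhere. *)
Definition limit_quotient (x : 'rV[R]_n) : R :=
  fine (limn_esup (fun k => (diff_quotient k x)%:E)).

Hypotheses (cf : continuous f)
  (iG : forall K, compact K -> (leb R n).-integrable K (EFin \o G))
  (qG : {ae leb R n, forall x k, `|diff_quotient k x| <= G x})
  (qcvg : {ae leb R n, forall x, cvgn (diff_quotient^~ x)}).

Let mf : measurable_fun [set: 'rV[R]_n] f.
Proof. exact: continuous_measurable_rV. Qed.

Let mq k : measurable_fun [set: 'rV[R]_n] (diff_quotient k).
Proof.
apply: measurable_funM => //; apply: measurable_funB => //.
apply: (measurableT_comp mf); exact: measurable_translation.
Qed.

Lemma measurable_limit_quotient : measurable_fun [set: 'rV[R]_n] limit_quotient.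
Proof.
apply: (measurableT_comp (fine_measurable measurableT)).
by apply: measurable_fun_limn_esup => k; exact/measurable_EFinP.
Qed.

Lemma limit_quotient_cvg :
  {ae leb R n, forall x, diff_quotient^~ x @ \oo --> limit_quotient x}.
Proof.
apply: filterS qcvg => x /= h.
suff -> : limit_quotient x = limn (diff_quotient^~ x) by [].
rewrite /limit_quotient; have : (fun k => (diff_quotient k x)%:E) @ \oo -->
    (limn (diff_quotient^~ x))%:E by apply: cvg_EFin => //; exact: nearW.
by move=> /cvg_limn_einf_sup[_ ->].
Qed.

Lemma limit_quotient_le : {ae leb R n, forall x, `|limit_quotient x| <= G x}.
Proof.
apply: filterS2 qG limit_quotient_cvg => x h1 h2.
have h3 : `|diff_quotient k x| @[k --> \oo] --> `|limit_quotient x|.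
  exact: cvg_norm.
rewrite -(cvg_lim _ h3)//; apply: limr_le; first by apply/cvg_ex; eexists; exact: h3.
by apply: nearW => k; exact: h1.
Qed.

Local Open Scope ereal_scope.

(** Translation invariance gives an integration by parts for each difference quotient; dominated
    convergence passes to the limit on both sides. *)
Lemma weak_partial_limit_quotient : weak_partial i f limit_quotient.
Proof.
move=> eta teta.
have ceta := test_function_continuous teta.
have meta : measurable_fun setT eta := continuous_measurable_rV ceta.
have [M M0 eta0] := test_function_supp teta.
have [L L0 etaL] := test_function_lipschitz i teta.
(* Shifts have length at most 1, so the cube of size M + 1 contains the support of every shifted
   test function and all points at which f is evaluated. *)
have [C C0 fC] := continuous_bounded_cube (M + 1)%R cf.
have [D D0 etaD'] := continuous_bounded_cube M ceta.
have etaD x : (`|eta x| <= D)%R.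
  have [/etaD'//|/eta0 ->] := pselect (cube M x); by rewrite normr0 ltW.
pose a (k : nat) : R := harmonic k.
have a0 k : (0 < a k)%R by exact: harmonic_gt0.
have a1 k : (a k <= 1)%R by rewrite /a/= invf_le1// ler1n.
pose r k (x : 'rV[R]_n) : R := ((eta (x + a k *: e) - eta x) / a k)%R.
have r0 k x : ~ cube (M + 1)%R x -> r k x = 0%R.
  move=> xM; rewrite /r !eta0 ?subrr ?mul0r// => /cubeP h; apply: xM; apply/cubeP => j.
    by have := h j; lra.
  have := h j; rewrite !mxE eqxx/=; have := a0 k; have := a1 k.
  by case: (_ == _); rewrite ?mulr1 ?mulr0 ?addr0 ?ler_norml; lra.
have rL k x : (`|r k x| <= L)%R.
  by rewrite /r normrM normfV (gtr0_norm (a0 k)) ler_pdivrMr//; exact: etaL.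
have mr k : measurable_fun setT (r k).
  apply: measurable_funM => //; apply: measurable_funB => //.
  by apply: (measurableT_comp meta); exact: measurable_translation.
have bd (h : 'rV[R]_n -> R) c : measurable_fun setT h -> (forall x, `|h x| <= c)%R ->
    (forall x, ~ cube (M + 1)%R x -> h x = 0%R) ->
    (leb R n).-integrable setT (EFin \o (fun x => (f x * h x)%R)).
  move=> mh hc h0; apply: (@integrable_cube_supp _ _ _ (C * c)%R (M + 1)%R).
  - by rewrite addr_ge0// ltW.
  - exact: measurable_funM.
  - move=> x; have [xM|xM] := pselect (cube (M + 1)%R x); last first.
      by rewrite h0// mulr0 normr0 mulr_ge0// ?(ltW C0)//; apply: le_trans (hc x).
    by rewrite normrM ler_pM// fC.
  - by move=> x xM; rewrite h0// mulr0.
have etaM1 x : ~ cube (M + 1)%R x -> eta x = 0%R.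
  by move=> xM; apply: eta0 => /cubeP h; apply: xM; apply/cubeP => j; have := h j; lra.
have int_feta := bd eta D meta etaD etaM1.
have int_fr k := bd (r k) L (mr k) (rL k) (r0 k).
have int_ft k : (leb R n).-integrable setT
    (EFin \o (fun x => (f x * eta (x + a k *: e))%R)).
  apply: (bd _ D) => [|//|x xM].
    by apply: (measurableT_comp meta); exact: measurable_translation.
  apply: eta0 => /cubeP h; apply: xM; apply/cubeP => j.
  have := h j; rewrite !mxE eqxx/=; have := a0 k; have := a1 k.
  by case: (_ == _); rewrite ?mulr1 ?mulr0 ?addr0 ?ler_norml; lra.
(* Discrete integration by parts: the term with f(x - a e) eta(x) is translated into f(x) eta(x + a
   e), and the two integrals are recombined. *)
have parts k : \int[leb R n]_x (diff_quotient k x * eta x)%:E =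
    - \int[leb R n]_x (f x * r k x)%:E.
  have tr := @leb_integral_translation R n (- (a k *: e))%R
    (fun x => (f x * eta (x + a k *: e))%:E) (measurable_int _ (int_ft k)).
  have int_tf : (leb R n).-integrable setT
      (EFin \o (fun x => (f (x - a k *: e) * eta x)%R)).
    apply: (@integrable_cube_supp _ _ _ (C * D)%R M); first exact: ltW.
    - apply: measurable_funM => //; apply: (measurableT_comp mf).
      exact: measurable_translation.
    - move=> x; have [xM|xM] := pselect (cube M x); last first.
        by rewrite eta0// mulr0 normr0 mulr_ge0// ltW.
      rewrite normrM ler_pM// fC//; apply/cubeP => j.
      move/cubeP : xM => /(_ j); rewrite !mxE eqxx/=; have := a0 k; have := a1 k.
      by case: (_ == _); rewrite ?mulr1 ?mulr0 ?subr0 ?ler_norml; lra.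
    - by move=> x xM; rewrite eta0// mulr0.
  have trE : \int[leb R n]_x (f (x - a k *: e) * eta x)%:E =
      \int[leb R n]_x (f x * eta (x + a k *: e))%:E.
    by rewrite -tr; apply: eq_integral => x _; rewrite subrK.
  have ak0 : a k != 0%R by rewrite gt_eqF.
  transitivity (\int[leb R n]_x ((a k)^-1%:E *
      ((f x * eta x)%:E - (f (x - a k *: e) * eta x)%:E))).
    apply: eq_integral => x _; rewrite -EFinB -EFinM; congr EFin.
    by rewrite /diff_quotient -/(a k); field.
  rewrite integralZl//; last exact: integrableB int_feta int_tf.
  rewrite integralB_EFin// trE.
  have -> : \int[leb R n]_x (f x * r k x)%:E = \int[leb R n]_x ((a k)^-1%:E *
      ((f x * eta (x + a k *: e))%:E - (f x * eta x)%:E)).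
    apply: eq_integral => x _; rewrite -EFinB -EFinM; congr EFin.
    by rewrite /r; field.
  rewrite integralZl//; last exact: integrableB (int_ft k) int_feta.
  rewrite integralB_EFin//.
  have /fineK <- := integrable_fin_num measurableT int_feta.
  have /fineK <- := integrable_fin_num measurableT (int_ft k).
  by rewrite -!EFinB -!EFinM -EFinN; congr EFin; ring.
(* The quotients of eta are bounded by L and supported in the larger cube, where |f| <= C; hence the
   constant C L on that cube dominates. *)
have cvr : \int[leb R n]_x (f x * r k x)%:E @[k --> \oo] -->
    \int[leb R n]_x (f x * partial i eta x)%:E.
  have [] := @dominated_convergence _ _ _ (leb R n) setT measurableT
    (fun k x => (f x * r k x)%:E) (fun x => (f x * partial i eta x)%:E)
    (EFin \o (fun x => (C * L * \1_(cube (M + 1)%R) x)%R)).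
  - by move=> k; exact: measurable_int (int_fr k).
  - apply/measurable_EFinP; apply: measurable_funM => //.
    by apply: continuous_measurable_rV; exact: test_function_partial_continuous.
  - apply: aeW => x _; apply: cvg_EFin; first exact: nearW.
    apply: cvgM; first exact: cvg_cst.
    exact: test_function_cvg.
  - apply: (@integrable_cube_supp _ _ _ (C * L)%R (M + 1)%R).
    + by rewrite addr_ge0// ltW.
    + by apply: measurable_funM => //; apply: measurable_indic; exact: measurable_cube.
    + move=> x; rewrite indicE normrM ger0_norm ?mulr_ge0 ?(ltW C0) ?(ltW L0)//.
      rewrite -[leRHS]mulr1 ler_wpM2l ?mulr_ge0 ?(ltW C0) ?(ltW L0)//.
      by case: (_ \in _); rewrite ?normr1 ?normr0.
    + by move=> x xM; rewrite indicE memNset// mulr0.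
  - apply: aeW => x k _; rewrite lee_fin /= indicE.
    have [xM|xM] := pselect (cube (M + 1)%R x).
      by rewrite mem_set// mulr1 normrM ler_pM// fC.
    by rewrite memNset// mulr0 r0// mulr0 normr0.
  by [].
(* Here D G dominates on the cube supporting eta, and it is integrable there by [iG]. *)
have cvq : \int[leb R n]_x (diff_quotient k x * eta x)%:E @[k --> \oo] -->
    \int[leb R n]_x (limit_quotient x * eta x)%:E.
  have [] := @dominated_convergence _ _ _ (leb R n) setT measurableT
    (fun k x => (diff_quotient k x * eta x)%:E) (fun x => (limit_quotient x * eta x)%:E)
    ((EFin \o (fun x => D * G x)%R) \_ (cube M)).
  - by move=> k; apply/measurable_EFinP; exact: measurable_funM.
  - by apply/measurable_EFinP; apply: measurable_funM => //; exact: measurable_limit_quotient.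
  - apply: filterS limit_quotient_cvg => x h _; apply: cvg_EFin; first exact: nearW.
    by apply: cvgM => //; exact: cvg_cst.
  - apply/(integrable_mkcond _ (measurable_cube M)).
    exact: (@integrableZl _ _ _ _ _ (measurable_cube M) D _ (iG (@cube_compact R n M))).
  - apply: filterS qG => x h k _; rewrite patchE.
    case: ifPn => xM; last first.
      by rewrite notin_setE in xM; rewrite eta0// mulr0 abse0.
    rewrite lee_fin /= normrM mulrC ler_pM//; exact: h.
  by [].
have cvq' : \int[leb R n]_x (diff_quotient k x * eta x)%:E @[k --> \oo] -->
    - \int[leb R n]_x (f x * partial i eta x)%:E.
  by under eq_fun do rewrite parts; exact: cvgeN.
by rewrite (cvg_unique _ cvq cvq')// oppeK.
Qed.

End difference_quotients.

(** * The norms on R^n *)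

Section minkowski.
Context {R : realType} {I : finType}.
Implicit Types (P : pred I) (a b : I -> R).

Let sqrt_sum_sq P a : Num.sqrt (\sum_(i | P i) a i ^+ 2) ^+ 2 = \sum_(i | P i) a i ^+ 2.
Proof. by rewrite sqr_sqrtr// sumr_ge0// => i _; exact: sqr_ge0. Qed.

(** With A and B the two norms, expanding the sum of (B a_i - A b_i)^2 >= 0 gives 2 A B (A B - sum
    a_i b_i) >= 0. The division by A B requires treating a vanishing norm first, in which case all
    its terms vanish. *)
Lemma cauchy_schwarz_sum P a b : \sum_(i | P i) a i * b i <=
  Num.sqrt (\sum_(i | P i) a i ^+ 2) * Num.sqrt (\sum_(i | P i) b i ^+ 2).
Proof.
have sa := sqrt_sum_sq P a; have sb := sqrt_sum_sq P b.
have A0 : 0 <= Num.sqrt (\sum_(i | P i) a i ^+ 2) by exact: sqrtr_ge0.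
have B0 : 0 <= Num.sqrt (\sum_(i | P i) b i ^+ 2) by exact: sqrtr_ge0.
set A := Num.sqrt (\sum_(i | P i) a i ^+ 2) in A0 sa *.
set B := Num.sqrt (\sum_(i | P i) b i ^+ 2) in B0 sb *.
have zero (f g : I -> R) : \sum_(i | P i) f i ^+ 2 = 0 -> \sum_(i | P i) f i * g i = 0.
  move=> f0; apply: big1 => i Pi; apply/eqP; rewrite mulf_eq0; apply/orP; left.
  have := f0; rewrite (bigD1 i)//= => /eqP.
  rewrite paddr_eq0 ?sqr_ge0 ?sumr_ge0//; last by move=> *; exact: sqr_ge0.
  by rewrite sqrf_eq0 => /andP[].
have [A00|An0] := eqVneq A 0.
  have z : \sum_(i | P i) a i ^+ 2 = 0 by rewrite -sa A00 expr0n.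
  by rewrite (zero _ _ z) A00 mul0r.
have [B00|Bn0] := eqVneq B 0.
  have z : \sum_(i | P i) b i ^+ 2 = 0 by rewrite -sb B00 expr0n.
  under eq_bigr do rewrite mulrC.
  by rewrite (zero _ _ z) B00 mulr0.
have AB : 0 < A * B by rewrite mulr_gt0// lt_neqAle eq_sym ?An0 ?Bn0.
have : 0 <= \sum_(i | P i) (B * a i - A * b i) ^+ 2.
  by rewrite sumr_ge0// => i _; exact: sqr_ge0.
rewrite (eq_bigr (fun i => B ^+ 2 * a i ^+ 2 + A ^+ 2 * b i ^+ 2
  - 2 * (A * B) * (a i * b i))); last by move=> i _; ring.
rewrite sumrB big_split/= -!mulr_sumr -sa -sb.
rewrite (_ : _ - _ = 2 * (A * B) * (A * B - \sum_(i | P i) a i * b i)); last by ring.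
by rewrite pmulr_rge0 ?subr_ge0//; lra.
Qed.

Lemma minkowski_sum P a b : Num.sqrt (\sum_(i | P i) (a i + b i) ^+ 2) <=
  Num.sqrt (\sum_(i | P i) a i ^+ 2) + Num.sqrt (\sum_(i | P i) b i ^+ 2).
Proof.
have A0 : 0 <= Num.sqrt (\sum_(i | P i) a i ^+ 2) by exact: sqrtr_ge0.
have B0 : 0 <= Num.sqrt (\sum_(i | P i) b i ^+ 2) by exact: sqrtr_ge0.
rewrite -(@ler_pXn2r _ 2)// ?nnegrE ?sqrtr_ge0 ?addr_ge0//.
rewrite sqrt_sum_sq sqrrD !sqrt_sum_sq.
rewrite (eq_bigr (fun i => a i ^+ 2 + b i ^+ 2 + 2 * (a i * b i))); last first.
  by move=> i _; ring.
rewrite !big_split/= -mulr_sumr mulr2n; have := cauchy_schwarz_sum P a b; lra.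
Qed.

End minkowski.

Section norm_theory.
Context {R : realType} {m : nat}.
Implicit Types (X Y : 'rV[R]_m.+1) (x : 'rV[R]_m).

Lemma heightE X : height X = X 0 ord_max.
Proof.
by rewrite /height (big_pred1 ord_max).
Qed.

Lemma horiz_norm_ge0 X : 0 <= horiz_norm X.
Proof. exact: sqrtr_ge0. Qed.

Lemma horiz_normD X Y : horiz_norm (X + Y) <= horiz_norm X + horiz_norm Y.
Proof.
rewrite /horiz_norm; under eq_bigr do rewrite mxE.
exact: minkowski_sum.
Qed.

Lemma horiz_normN X : horiz_norm (- X) = horiz_norm X.
Proof. by rewrite /horiz_norm; under eq_bigr do rewrite mxE sqrrN. Qed.

Lemma horiz_norm_dist X Y : `|horiz_norm X - horiz_norm Y| <= horiz_norm (X - Y).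
Proof.
have := horiz_normD (X - Y) Y; have := horiz_normD (Y - X) X; rewrite !subrK.
by rewrite -opprB horiz_normN ler_norml; move=> *; apply/andP; split; lra.
Qed.

Lemma tnormE X : tnorm X = horiz_norm X + `|X 0 ord_max|.
Proof. by rewrite /tnorm heightE. Qed.

Lemma tnorm_ge0 X : 0 <= tnorm X.
Proof. by rewrite addr_ge0// horiz_norm_ge0. Qed.

Lemma tnormN X : tnorm (- X) = tnorm X.
Proof. by rewrite !tnormE horiz_normN mxE normrN. Qed.

Lemma tnormD X Y : tnorm (X + Y) <= tnorm X + tnorm Y.
Proof.
rewrite !tnormE mxE.
have := horiz_normD X Y; have := ler_normD (X 0 ord_max) (Y 0 ord_max); lra.
Qed.

Lemma tnorm_dist X Y : `|tnorm X - tnorm Y| <= tnorm (X - Y).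
Proof.
have := tnormD (X - Y) Y; have := tnormD (Y - X) X; rewrite !subrK.
by rewrite -opprB tnormN ler_norml; move=> *; apply/andP; split; lra.
Qed.

Lemma horiz_norm_sqr X :
  horiz_norm X ^+ 2 = \sum_(i < m.+1 | i.+1 != m.+1) X 0 i ^+ 2.
Proof. by rewrite sqr_sqrtr// sumr_ge0// => i _; exact: sqr_ge0. Qed.

Lemma coord_le_horiz_norm X i : i != ord_max -> `|X 0 i| <= horiz_norm X.
Proof.
move=> im; rewrite -(@ler_pXn2r _ 2)// ?nnegrE ?horiz_norm_ge0// horiz_norm_sqr.
rewrite real_normK ?num_real// (bigD1 i)/=.
  by rewrite lerDl sumr_ge0// => *; exact: sqr_ge0.
by rewrite eqSS; apply: contra im => /eqP h; apply/eqP/val_inj.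
Qed.

Lemma coord_le_tnorm X i : `|X 0 i| <= tnorm X.
Proof.
have h0 := horiz_norm_ge0 X.
rewrite tnormE; have [->|im] := eqVneq i ord_max; first lra.
by have := coord_le_horiz_norm X im; have := normr_ge0 (X 0 ord_max); lra.
Qed.

Lemma enorm_sqr X : enorm X ^+ 2 = horiz_norm X ^+ 2 + X 0 ord_max ^+ 2.
Proof.
rewrite horiz_norm_sqr sqr_sqrtr; last by rewrite sumr_ge0// => *; exact: sqr_ge0.
rewrite (bigID (fun i : 'I_m.+1 => i.+1 != m.+1))/=; congr +%R.
rewrite (big_pred1 ord_max)// => i /=.
by rewrite negbK eqSS; apply/eqP/eqP => [h|->//]; exact/val_inj.
Qed.

Lemma enorm_le_tnorm X : enorm X <= tnorm X.
Proof.
rewrite -(@ler_pXn2r _ 2)// ?nnegrE ?sqrtr_ge0 ?tnorm_ge0//.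
rewrite enorm_sqr tnormE sqrrD (real_normK (num_real _)).
by have := mulr_ge0 (horiz_norm_ge0 X) (normr_ge0 (X 0 ord_max)); lra.
Qed.

(** This connects the norm with the topology of the sup norm; the constant is crude, using m + 1 <=
    (m + 1)^2 in place of a square root. *)
Lemma tnorm_le_norm X : tnorm X <= m.+2%:R * `|X|.
Proof.
have xi i : `|X 0 i| <= `|X| by exact: coord_le_norm.
have : horiz_norm X <= m.+1%:R * `|X|.
  rewrite -(@ler_pXn2r _ 2)// ?nnegrE ?horiz_norm_ge0 ?mulr_ge0// horiz_norm_sqr.
  apply: (@le_trans _ _ (\sum_(i < m.+1) `|X| ^+ 2)).
    rewrite big_mkcond; apply: ler_sum => i _; case: ifPn => _; last exact: sqr_ge0.
    by rewrite -[X in X <= _]real_normK ?num_real// lerXn2r ?nnegrE.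
  rewrite sumr_const card_ord exprMn -[leLHS]mulr_natl ler_wpM2r ?sqr_ge0//.
  by rewrite -natrX ler_nat expnS leq_pmulr.
by rewrite tnormE -[in m.+2]addn1 natrD mulrDl mul1r; have := xi ord_max; lra.
Qed.

Lemma tnorm_continuous : continuous (fun X : 'rV[R]_m.+1 => tnorm X).
Proof.
move=> X P /nbhs_ballP[e /= e0 eP].
have e1 : 0 < e / m.+2%:R by rewrite divr_gt0.
apply/nbhs_ballP; exists (e / m.+2%:R) => // Y; rewrite -ball_normE /ball_/= => XY.
apply: eP; rewrite /ball/=; apply: le_lt_trans (tnorm_dist _ _) _.
apply: le_lt_trans (tnorm_le_norm _) _.
by rewrite mulrC -ltr_pdivlMr.
Qed.

Lemma tnorm_eq0 X : tnorm X = 0 -> X = 0.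
Proof.
move=> h; apply/rowP => i; apply/eqP; rewrite mxE -normr_eq0; apply/eqP/le_anti.
by rewrite normr_ge0 -h coord_le_tnorm.
Qed.

Lemma tnorm_delta (a : R) (i : 'I_m.+1) :
  tnorm (a *: delta_mx 0 i : 'rV[R]_m.+1) <= `|a|.
Proof.
rewrite tnormE !mxE; have [im|im] := eqVneq ord_max i.
  rewrite mulr1 /horiz_norm big1 ?sqrtr0 ?add0r// => j jm; rewrite !mxE/=.
  case: eqP => [e|_]; last by rewrite mulr0 expr0n.
  by move: jm; rewrite e -im eqxx.
rewrite mulr0 normr0 addr0 -(@ler_pXn2r _ 2)// ?nnegrE ?horiz_norm_ge0//.
rewrite horiz_norm_sqr real_normK ?num_real//.
rewrite (bigD1 i)/=; last first.
  by rewrite eqSS; apply: contra im => /eqP h; apply/eqP/esym/val_inj.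
rewrite big1 ?addr0; first by rewrite !mxE !eqxx mulr1.
by move=> j /andP[_ ji]; rewrite !mxE (negbTE ji) andbF mulr0 expr0n.
Qed.

Lemma horiz_norm_snoc x (t : R) : horiz_norm (snoc_rV (x, t)) = enorm x.
Proof.
rewrite /horiz_norm /enorm big_mkcond big_ord_recr/= eqxx addr0; congr Num.sqrt.
apply: eq_bigr => i _; rewrite eqSS ltn_eqF//=.
have -> : widen_ord (leqnSn m) i = lift ord_max i.
  by apply/val_inj; rewrite /= /bump leqNgt ltn_ord.
by rewrite mxE liftK.
Qed.

Lemma snoc_ord_max x (t : R) : snoc_rV (x, t) 0 ord_max = t.
Proof. by rewrite mxE unlift_none. Qed.

End norm_theory.

(** * Local integrability of the slope *)

(* [leb R n] as a plain function, to which a sigma-finite instance can be attached. *)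
Definition leb_fun (R : realType) n : set 'rV[R]_n -> \bar R := leb R n.

HB.instance Definition _ (R : realType) n := Measure.copy (@leb_fun R n) (leb R n).

HB.instance Definition _ (R : realType) n := Measure_isSigmaFinite.Build _ _ R
  (@leb_fun R n) (@leb_sigma_finite R n).

(* By Tonelli: slope(||X||)^n is at most twice the integral of slope(s)^n / s over
   [||X|| / 2, ||X||], and the set ||X|| <= 2 s has measure at most (4 s)^n.
   At the origin [slope phi 0 = 0], because [x / 0 = 0]. *)
Section radial.
Context {R : realType} {m : nat}.
Local Notation N := m.+1.
Variable phi : R -> R.
Hypotheses (phi_ge0 : forall s : R, 0 <= s -> 0 <= phi s)
  (phi_le : forall s t : R, 0 <= s -> s <= t -> phi s <= phi t)
  (phi_ge1 : forall s : R, 1 <= s -> phi s = s)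
  (slope_le : forall s t : R, 0 < s -> s <= t -> slope phi t <= slope phi s)
  (phi3 : cond_C3 phi N).
Local Notation psi := (slope phi).

Let psi_ge0 s : 0 <= s -> 0 <= psi s.
Proof. by move=> s0; rewrite divr_ge0 ?phi_ge0. Qed.

(** A version of the slope that is measurable on the whole line: composing phi with [Num.max s 0]
    gives a monotone function. On [0, +oo[ it agrees with the slope, including the value 0 at 0. *)
Let psip s : R := phi (Num.max s 0) * s `^ (-1).

Let psipE s : 0 <= s -> psip s = psi s.
Proof. by move=> s0; rewrite /psip max_l// powR_inv1. Qed.

Let measurable_psip : measurable_fun [set: R] psip.
Proof.
apply: measurable_funM; last exact: measurable_powR.
apply: nondecreasing_measurable => // s t st.
apply: phi_le; first by rewrite le_max lexx orbT.
by rewrite ge_max !le_max st lexx orbT.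
Qed.

Lemma measurable_slope_tnorm :
  measurable_fun [set: 'rV[R]_N] (fun X : 'rV[R]_N => psi (tnorm X)).
Proof.
rewrite (_ : (fun X => _) = psip \o (fun X : 'rV[R]_N => tnorm X)); last first.
  by apply/funext => X; rewrite /= psipE// tnorm_ge0.
apply: measurableT_comp => //; apply: continuous_measurable_rV; exact: tnorm_continuous.
Qed.

Let u : R -> R := (fun s => psip s ^+ N * s `^ (-1)) \_ `]0, 1].

Let uE s : 0 < s <= 1 -> u s = psi s ^+ N / s.
Proof.
move=> s01; rewrite /u patchE mem_set/=; last by rewrite /= in_itv.
by rewrite psipE ?powR_inv1//; lra.
Qed.

Let u0 s : ~ (0 < s <= 1) -> u s = 0.
Proof. by move=> s01; rewrite /u patchE memNset. Qed.

Let u_ge0 s : 0 <= u s.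
Proof.
have [s01|s01] := pselect (0 < s <= 1); last by rewrite u0.
by rewrite uE// divr_ge0 ?exprn_ge0 ?psi_ge0//; lra.
Qed.

Let measurable_u : measurable_fun [set: R] u.
Proof.
have mI : measurable (`]0, 1]%classic : set R) by exact: measurable_itv.
apply: (proj1 (measurable_restrictT _ mI)); apply: measurable_funTS.
apply: measurable_funM; last exact: measurable_powR.
exact: measurable_funX.
Qed.

Let A : set ('rV[R]_N * R) := [set p | p.2 <= tnorm p.1 /\ tnorm p.1 <= 2 * p.2].

Let measurable_A : measurable A.
Proof.
have mt : measurable_fun [set: 'rV[R]_N * R] (fun p : 'rV[R]_N * R => tnorm p.1).
  apply: (@measurableT_comp _ _ _ _ _ _ (fun X : 'rV[R]_N => tnorm X)) => //.
  apply: continuous_measurable_rV; exact: tnorm_continuous.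
rewrite (_ : A = (setT `&` [set p | p.2 <= tnorm p.1]) `&`
   (setT `&` [set p | tnorm p.1 <= 2 * p.2])); last first.
  by rewrite !setTI; apply/seteqP; split => p [].
apply: measurableI; apply: measurable_fun_le => //.
exact: measurable_funM.
Qed.

Let h (p : 'rV[R]_N * R) : \bar R := (u p.2 * \1_A p)%:E.

Let h_ge0 p : (0 <= h p)%E.
Proof. by rewrite lee_fin mulr_ge0 ?u_ge0// indicE. Qed.

Let measurable_h : measurable_fun setT h.
Proof.
apply/measurable_EFinP; apply: measurable_funM.
  exact: (measurableT_comp measurable_u).
exact: measurable_indic.
Qed.

Let F X : \bar R := (\int[lebesgue_measure]_s h (X, s))%E.

(** On [rho/2, rho] both slope(s)^N and 1/s are at least their values at rho, and the interval has
    length rho/2. *)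
Let slope_le_F (X : 'rV[R]_N) : 0 < tnorm X <= 1 ->
  ((psi (tnorm X) ^+ N)%:E <= 2%:E * F X)%E.
Proof.
set rho := tnorm X => /andP[r0 r1].
pose c := psi rho ^+ N / rho.
have c0 : 0 <= c by rewrite divr_ge0 ?exprn_ge0 ?psi_ge0 ?(ltW r0).
have mhX : measurable_fun setT (fun s => h (X, s)).
  by apply: (measurableT_comp measurable_h); exact: pair1_measurable.
have c_le (s : R) : rho / 2 <= s <= rho -> (c%:E <= h (X, s))%E.
  move=> /andP[s1 s2]; have s0 : 0 < s by lra.
  rewrite lee_fin indicE mem_set ?mulr1; last by split => /=; rewrite -/rho; lra.
  rewrite /= uE; last by lra.
  apply: ler_pM; rewrite ?exprn_ge0 ?psi_ge0 ?invr_ge0 ?(ltW r0)//.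
    by rewrite lerXn2r ?nnegrE ?psi_ge0 ?(ltW r0) ?(ltW s0)//; exact: slope_le.
  by rewrite lef_pV2 ?posrE.
have : (\int[lebesgue_measure]_(s in `[(rho / 2)%R, rho]) (cst c%:E) s <= F X)%E.
  apply: (@le_trans _ _ (\int[lebesgue_measure]_(s in `[(rho / 2)%R, rho]) h (X, s))%E).
    apply: ge0_le_integral => //.
    exact: measurable_funTS.
  by rewrite /F; apply: ge0_subset_integral => //; exact: measurable_itv.
rewrite integral_cst//= lebesgue_measure_itv/= lte_fin ifT; last by lra.
rewrite -EFinB -EFinM => hF.
have -> : psi rho ^+ N = 2 * (c * (rho - rho / 2)) by rewrite /c; field; lra.
by rewrite EFinM lee_wpmul2l.
Qed.

Let tnorm_ball_le (s : R) : 0 < s ->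
  (leb R N [set X : 'rV[R]_N | (s <= tnorm X)%R /\ (tnorm X <= 2 * s)%R] <= ((4 * s) ^+ N)%:E)%E.
Proof.
move=> s0.
have := @leb_box R N (const_mx (- (2 * s))) (const_mx (2 * s)).
rewrite (_ : \prod_(i < N) _ = (4 * s) ^+ N); last first.
  rewrite (eq_bigr (fun=> 4 * s)) ?prodr_const ?card_ord//.
  by move=> i _; rewrite !mxE; ring.
move=> <-; last by move=> i; rewrite !mxE; lra.
apply: le_measure.
- rewrite inE; rewrite (_ : [set _ | _] = ysection A s).
    exact: measurable_ysection.
  by apply/funext => X; rewrite ysectionE.
- rewrite inE; apply: (@measurable_box _ _ (fun i =>
    [set` `[const_mx (- (2 * s)) 0 i, const_mx (2 * s) 0 i]])) => i.
  exact: measurable_itv.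
- move=> X /= [_ hX] i; rewrite in_itv/= !mxE -ler_norml.
  exact: le_trans (coord_le_tnorm X i) hX.
Qed.

(** After exchanging the integrals, the integrand in s is at most slope(s)^N / s times (4 s)^N, that
    is 4^N phi(s)^N / s, whose integral over ]0, 1] is finite by [cond_C3]. *)
Let F_fin : (\int[leb R N]_X F X < +oo)%E.
Proof.
pose mu : {sigma_finite_measure set 'rV[R]_N -> \bar R} := @leb_fun R N.
have := @fubini_tonelli _ _ _ _ R mu lebesgue_measure h measurable_h h_ge0.
rewrite /F => ->.
have mg : measurable_fun (`]0, 1]%classic : set R)
    (fun s => (`|phi s| ^+ N / s)%:E).
  apply/measurable_EFinP.
  suff : measurable_fun (`]0, 1]%classic : set R)
      (fun s : R => `|phi (Num.max s 0)| ^+ N * s `^ (-1)).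
    apply: eq_measurable_fun => s; rewrite inE/= in_itv/= => /andP[s0 _].
    by rewrite max_l ?powR_inv1 ?ltW.
  apply: measurable_funTS; apply: measurable_funM; last exact: measurable_powR.
  apply: measurable_funX; apply: measurableT_comp => //.
  apply: nondecreasing_measurable => // s t st.
  apply: phi_le; first by rewrite le_max lexx orbT.
  by rewrite ge_max !le_max st lexx orbT.
have g0 s : (`]0, 1]%classic : set R) s -> (0 <= (`|phi s| ^+ N / s)%:E)%E.
  by rewrite /= in_itv/= => /andP[s0 _]; rewrite lee_fin divr_ge0 ?exprn_ge0// ltW.
apply: (@le_lt_trans _ _ (\int[lebesgue_measure]_(s in `]0%R, 1%R])
    ((4 ^+ N)%:E * (`|phi s| ^+ N / s)%:E))%E); last first.
  by rewrite ge0_integralZl// lte_mul_pinfty// lee_fin exprn_ge0.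
rewrite [leRHS]integral_mkcond.
apply: ge0_le_integral => //.
- by move=> s _; apply: integral_ge0.
- exact: (@measurable_fun_fubini_tonelli_G _ _ _ _ R mu h).
- have mI : measurable (`]0, 1]%classic : set R) by exact: measurable_itv.
  by apply: (proj1 (measurable_restrictT _ mI)); exact: measurable_funeM.
move=> s _.
have hE X : h (X, s) = ((u s)%:E * (\1_(ysection A s) X)%:E)%E.
  by rewrite -EFinM /h/= !indicE mem_ysection.
have mys : measurable (ysection A s) by exact: measurable_ysection.
under eq_integral do rewrite hE.
rewrite ge0_integralZl//; last 2 first.
- by apply/measurable_EFinP; exact: measurable_indic.
- by rewrite lee_fin u_ge0.
rewrite integral_indic// setIT patchE; case: ifPn => [|/negP] s01; last first.
  by rewrite u0 ?mul0e//; apply: contra_not s01 => s01; rewrite inE/= in_itv/= s01.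
move: s01; rewrite inE/= in_itv/= => s01.
rewrite uE//.
have s0 : 0 < s by lra.
apply: (@le_trans _ _ ((psi s ^+ N / s)%:E * ((4 * s) ^+ N)%:E)%E).
  rewrite lee_wpmul2l ?lee_fin ?divr_ge0 ?exprn_ge0 ?psi_ge0 ?(ltW s0)//.
  rewrite (_ : ysection A s = [set X | s <= tnorm X /\ (tnorm X <= 2 * s)%R]).
    exact: tnorm_ball_le.
  by apply/funext => X; rewrite ysectionE.
rewrite -!EFinM lee_fin ger0_norm ?phi_ge0 ?(ltW s0)//.
rewrite /slope !exprMn exprVn le_eqVlt; apply/orP; left; apply/eqP.
by field; rewrite expf_neq0; lra.
Qed.

(** The integrand is dominated by 2 F + 1: the first term serves the unit ball, the second the
    outside, where the slope is 1. *)
Lemma integral_slope_tnorm (K : set 'rV[R]_N) : compact K ->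
  (\int[leb R N]_(X in K) (psi (tnorm X) ^+ N)%:E < +oo)%E.
Proof.
move=> cK; have mK := compact_measurable_rV cK.
have mF : measurable_fun setT F.
  exact: (@measurable_fun_fubini_tonelli_F _ _ _ _ R lebesgue_measure h).
have F0 X : (0 <= F X)%E by exact: integral_ge0.
apply: (@le_lt_trans _ _ (\int[leb R N]_(X in K) (2%:E * F X + cst 1%E X))%E).
  apply: ge0_le_integral => //.
  - by move=> X _; rewrite lee_fin exprn_ge0// psi_ge0// tnorm_ge0.
  - apply/measurable_EFinP; apply: measurable_funX; apply: measurable_funTS.
    exact: measurable_slope_tnorm.
  - apply: emeasurable_funD => //; apply: measurable_funeM.
    exact: measurable_funTS.
  - move=> X _; have := tnorm_ge0 X; rewrite le_eqVlt => /predU1P[X0|X0].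
      by rewrite -X0 /slope invr0 mulr0 expr0n/= adde_ge0// mule_ge0.
    have [X1|X1] := leP (tnorm X) 1.
      apply: (@le_trans _ _ (2%:E * F X)%E); first by apply: slope_le_F; rewrite X0.
      by rewrite leeDl.
    rewrite /slope phi_ge1 ?(ltW X1)// divff ?gt_eqF// expr1n.
    by rewrite leeDr// mule_ge0.
rewrite ge0_integralD//; last 2 first.
- by move=> X _; rewrite mule_ge0.
- by apply: measurable_funeM; exact: measurable_funTS.
rewrite integral_cst// mul1e.
have Kfin := compact_leb_fin cK.
rewrite lte_add_pinfty// ge0_integralZl//; last exact: measurable_funTS.
rewrite lte_mul_pinfty//.
apply: le_lt_trans F_fin; apply: ge0_subset_integral => //.
Qed.

(** Away from the origin the slope is at least 1, hence at most its N-th power; at the origin both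
    are 0. *)
Lemma integrable_slope_tnorm (K : set 'rV[R]_N) : compact K ->
  (leb R N).-integrable K (EFin \o (fun X : 'rV[R]_N => psi (tnorm X))).
Proof.
move=> cK; have mK := compact_measurable_rV cK.
apply/integrableP; split.
  by apply/measurable_EFinP; apply: measurable_funTS; exact: measurable_slope_tnorm.
apply: le_lt_trans (integral_slope_tnorm cK); apply: ge0_le_integral => //.
- apply: measurableT_comp => //; apply/measurable_EFinP; apply: measurable_funTS.
  exact: measurable_slope_tnorm.
- apply/measurable_EFinP; apply: measurable_funX; apply: measurable_funTS.
  exact: measurable_slope_tnorm.
move=> X _; rewrite lee_fin ger0_norm ?psi_ge0 ?tnorm_ge0//.
have := tnorm_ge0 X; rewrite le_eqVlt => /predU1P[X0|X0].
  by rewrite -X0 /slope invr0 mulr0 expr0n.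
have p1 : 1 <= psi (tnorm X).
  have [X1|X1] := leP (tnorm X) 1.
    by have := slope_le X0 X1; rewrite {1}/slope phi_ge1// divr1.
  by rewrite /slope phi_ge1 ?(ltW X1)// divff// gt_eqF.
by rewrite exprS ler_peMr ?exprn_ege1//; lra.
Qed.

End radial.

(** * A sufficient condition for Sobolev regularity *)

Section null_sets.
Context {R : realType} {m : nat}.
Local Open Scope ereal_scope.

Lemma leb_set0 : leb R m.+1 [set 0%R] = 0.
Proof.
have := @leb_box R m.+1 0%R 0%R (fun i => lexx _).
rewrite (_ : [set v | _] = [set 0%R]); last first.
  apply/seteqP; split => [v /= h|v /= -> i]; last by rewrite in_itv/= lexx.
  apply/rowP => i; have := h i; rewrite in_itv/= => /andP[h1 h2].
  by apply/le_anti; rewrite h1 h2.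
by move=> ->; rewrite big_ord_recl !mxE subrr mul0r.
Qed.

(** By sections: those over x != 0 are countable, hence null, and the single base point x = 0 is
    null because the base has positive dimension. *)
Lemma leb_null_vertical (A : set 'rV[R]_m.+2) : measurable A ->
  (forall x : 'rV[R]_m.+1, x != 0%R -> countable [set t | A (snoc_rV (x, t))]) ->
  leb R m.+2 A = 0.
Proof.
move=> mA hA; pose B := @snoc_rV R m.+1 @^-1` A.
have mB : measurable B.
  by rewrite -[B]setTI; exact: measurable_snoc_rV.
have -> : leb R m.+2 A = \int[leb R m.+1]_x (lebesgue_measure \o xsection B) x by [].
rewrite (@ae_eq_integral _ _ _ _ setT (cst 0))//.
- by rewrite integral0.
- exact: measurable_fun_xsection.
- exists [set 0%R]; split => //.
  + by apply: compact_measurable_rV; exact: compact_set1.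
  + exact: leb_set0.
  + move=> x /= h; apply: contrapT => /eqP x0; apply: h => _.
    apply: countable_lebesgue_measure0.
    rewrite (_ : xsection B x = [set t | A (snoc_rV (x, t))]); first exact: hA.
    by apply/funext => t; rewrite xsectionE.
Qed.

End null_sets.

Lemma limn_einf_esup_cvg (R : realType) (u : nat -> R) :
  limn_einf (EFin \o u) = limn_esup (EFin \o u) ->
  limn_esup (EFin \o u) \is a fin_num -> cvgn u.
Proof.
move=> h1 h2.
have hs : esups (EFin \o u) @ \oo --> limn_esup (EFin \o u).
  by rewrite limn_esup_lim; exact: is_cvg_esups.
have hi : einfs (EFin \o u) @ \oo --> limn_esup (EFin \o u).
  by rewrite -h1 limn_einf_lim; exact: is_cvg_einfs.
have : EFin \o u @ \oo --> limn_esup (EFin \o u).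
  apply: squeeze_cvge hi hs; apply: nearW => k.
  by apply/andP; split; [apply: ereal_inf_lbound|apply: ereal_sup_ubound]; exists k => /=.
rewrite -(fineK h2) => /fine_cvg h; apply/cvg_ex; eexists; exact: h.
Qed.

(** The set of divergence is replaced by the set where the limits inferior and superior differ or
    are infinite. That set is measurable, so the vertical criterion for null sets applies to it. *)
Lemma ae_cvg_vertical (R : realType) m (q : nat -> 'rV[R]_m.+2 -> R) :
  (forall k, measurable_fun setT (q k)) ->
  (forall x : 'rV[R]_m.+1, x != 0 -> exists2 E : set R, countable E &
    forall t, ~ E t -> cvgn (q^~ (snoc_rV (x, t)))) ->
  {ae leb R m.+2, forall X, cvgn (q^~ X)}.
Proof.
move=> mq hq.
pose s X := limn_esup (fun k => (q k X)%:E); pose i X := limn_einf (fun k => (q k X)%:E).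
have ms : measurable_fun setT s.
  by apply: measurable_fun_limn_esup => k; exact/measurable_EFinP.
have mi : measurable_fun setT i.
  rewrite (_ : i = (fun X => - limn_esup (fun k => (- q k X)%R%:E))%E).
    apply: measurableT_comp => //; apply: measurable_fun_limn_esup => k.
    exact/measurable_EFinP/measurableT_comp.
  by apply/funext => X; rewrite -limn_einfN; congr limn_einf; apply/funext => k /=; rewrite opprK.
pose D := (setT `&` [set X | i X != s X]) `|` (setT `&` [set X | s X \isn't a fin_num]).
have mD : measurable D.
  apply: measurableU; first exact: measurable_neqe.
  rewrite setTI (_ : [set X | _] = ~` (setT `&` [set X | s X \is a fin_num])).
    by apply: measurableC; exact: emeasurable_fin_num.
  by rewrite setTI; apply/seteqP; split => X /= /negP.
exists D; split => //.
  apply: leb_null_vertical => // x x0; have [E cE hE] := hq x x0.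
  apply: sub_countable cE; apply: subset_card_le => t /=.
  apply: contraPP => /hE /cvg_ex[l hl].
  have hl' : (q k (snoc_rV (x, t)))%:E @[k --> \oo] --> l%:E.
    by apply: cvg_EFin hl; exact: nearW.
  have [h1 h2] := cvg_limn_einf_sup hl'.
  rewrite /D /s /i => -[[_ /=]|[_ /=]]; first by rewrite h1 h2 eqxx.
  by rewrite h2.
move=> X /= hX; apply: contrapT => hD; apply: hX; apply: limn_einf_esup_cvg.
  by apply/eqP; apply: contrapT => /negP h; apply: hD; left.
by apply: contrapT => /negP h; apply: hD; right.
Qed.

Section lp_loc.
Context {R : realType} {n : nat}.
Implicit Types f : 'rV[R]_n -> R.

Lemma continuous_Lp_loc p f : continuous f -> Lp_loc p f.
Proof.
move=> cf; have mf := continuous_measurable_rV cf; split => // K cK.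
have mK := compact_measurable_rV cK.
have [M M0 KM] := compact_bounded_rV cK.
have [C C0 fC] := continuous_bounded_cube M cf.
apply: (@le_lt_trans _ _ (\int[leb R n]_(x in K) (cst (C ^+ p)%:E x))%E).
  apply: ge0_le_integral => //.
  - apply/measurable_EFinP; apply: measurable_funX; apply: measurable_funTS.
    exact: measurableT_comp.
  - move=> x Kx; rewrite lee_fin lerXn2r ?nnegrE ?(ltW C0)//.
    by apply: fC; apply/cubeP; exact: KM.
rewrite integral_cst// lte_mul_pinfty ?lee_fin ?exprn_ge0 ?(ltW C0)//.
exact: compact_leb_fin.
Qed.

End lp_loc.

Section sobolev_criterion.
Context {R : realType} {m : nat}.
Local Notation N := m.+2.
Variable phi : R -> R.
Hypotheses (phi_ge0 : forall s : R, 0 <= s -> 0 <= phi s)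
  (phi_le : forall s t : R, 0 <= s -> s <= t -> phi s <= phi t)
  (phi_ge1 : forall s : R, 1 <= s -> phi s = s)
  (slope_le : forall s t : R, 0 < s -> s <= t -> slope phi t <= slope phi s)
  (phi3 : cond_C3 phi N).
Variables (f : 'rV[R]_N -> R) (C : R).
Hypotheses (C0 : 0 <= C) (cf : continuous f)
  (fC : forall X Y, X != 0 ->
    `|f X - f Y| <= C * slope phi (tnorm X) * tnorm (X - Y))
  (df : forall x : 'rV[R]_m.+1, x != 0 -> exists2 E : set R, countable E &
    forall t, ~ E t -> forall i, derivable f (snoc_rV (x, t)) (delta_mx 0 i)).

Let G (X : 'rV[R]_N) := C * slope phi (tnorm X).

Let G_ge0 X : 0 <= G X.
Proof. by rewrite mulr_ge0// divr_ge0 ?phi_ge0// tnorm_ge0. Qed.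

Let measurable_G : measurable_fun setT G.
Proof. by apply: measurable_funM => //; exact: measurable_slope_tnorm. Qed.

Let quotient_le i : {ae leb R N, forall X k, `|diff_quotient f i k X| <= G X}.
Proof.
exists [set 0]; split; [|exact: leb_set0|].
- by apply: compact_measurable_rV; exact: compact_set1.
- move=> X /= h; apply: contrapT => /eqP X0; apply: h => k.
  have a0 : 0 < harmonic k :> R by exact: harmonic_gt0.
  rewrite /diff_quotient normrM normfV (gtr0_norm a0) ler_pdivrMr//.
  apply: le_trans (fC _ X0) _; rewrite opprB addrC subrK -/(G X) ler_wpM2l//.
  by rewrite -[leRHS](gtr0_norm a0); exact: tnorm_delta.
Qed.

Let quotient_cvg i : {ae leb R N, forall X, cvgn (diff_quotient f i ^~ X)}.
Proof.
apply: ae_cvg_vertical => [k|x x0].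
  have mf := continuous_measurable_rV cf.
  apply: measurable_funM => //; apply: measurable_funB => //.
  by apply: (measurableT_comp mf); exact: measurable_translation.
have [E cE hE] := df x0; exists E => // t /hE /(_ i) d.
set X := snoc_rV (x, t) in d *.
have h0 : (fun k => - harmonic k) @ \oo --> (0 : R)^'.
  move=> P hP.
  have H : \forall k \near \oo, - harmonic k != 0 :> R -> P (- harmonic k).
    have hN : (fun k => - harmonic k) @ \oo --> (0 : R).
      by rewrite -oppr0; apply: cvgN; exact: cvg_harmonic.
    exact: (hN _ hP).
  suff : \forall k \near \oo, P (- harmonic k) by [].
  by apply: filterS H => k; apply; rewrite oppr_eq0 gt_eqF ?harmonic_gt0.
(* The backward quotient is the quotient defining the directional derivative, taken at the increment
   - 1/(k + 1). *)
have -> : diff_quotient f i ^~ X = (fun h : R => h^-1 *: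
    ((f \o shift X) (h *: delta_mx 0 i) - f X)) \o (fun k => - harmonic k).
  apply/funext => k; rewrite /diff_quotient /= scaleNr (addrC X) /GRing.scale/=.
  by rewrite invrN mulNr mulrC -mulrN opprB.
by apply/cvg_ex; eexists; exact: cvg_comp h0 d.
Qed.

(** The weak derivative is the limit of the quotients; it inherits almost everywhere their bound C
    slope(||X||), whose N-th power is integrable on compact sets. *)
Lemma modulus_W1p_loc_fun : W1p_loc_fun N f.
Proof.
split; first exact: continuous_Lp_loc.
move=> i; have iG K : compact K -> (leb R N).-integrable K (EFin \o G).
  move=> cK; have mK := compact_measurable_rV cK.
  have iK := @integrable_slope_tnorm R m.+1 phi phi_ge0 phi_le phi_ge1 slope_le phi3 K cK.
  exact: (@integrableZl _ _ _ _ _ mK C _ iK).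
exists (limit_quotient f i); last first.
  exact: (weak_partial_limit_quotient cf iG (quotient_le i) (quotient_cvg i)).
have ml := measurable_limit_quotient i cf.
split => // K cK; have mK := compact_measurable_rV cK.
apply: (@le_lt_trans _ _ (\int[leb R N]_(X in K)
    ((C ^+ N)%:E * (slope phi (tnorm X) ^+ N)%:E))%E).
  apply: ae_ge0_le_integral => //.
  - apply/measurable_EFinP; apply: measurable_funX; apply: measurable_funTS.
    exact: measurableT_comp.
  - by move=> X _; rewrite -EFinM lee_fin -exprMn exprn_ge0//; exact: G_ge0.
  - apply: measurable_funeM; apply/measurable_EFinP; apply: measurable_funX.
    apply: measurable_funTS.
    exact: measurable_slope_tnorm.
  - apply: filterS (limit_quotient_le (quotient_le i) (quotient_cvg i)) => X hX _.
    by rewrite -EFinM lee_fin -exprMn lerXn2r ?nnegrE ?(G_ge0 X).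
rewrite ge0_integralZl//.
- rewrite lte_mul_pinfty ?lee_fin ?exprn_ge0//.
  exact: (@integral_slope_tnorm R m.+1 phi).
- apply/measurable_EFinP; apply: measurable_funX; apply: measurable_funTS.
  exact: measurable_slope_tnorm.
- by move=> X _; rewrite lee_fin exprn_ge0// divr_ge0 ?phi_ge0// tnorm_ge0.
- by rewrite lee_fin exprn_ge0.
Qed.

End sobolev_criterion.

(** * The homeomorphism *)

Section vertical_map.
Context {R : realType} {m : nat}.
Variable w : R -> R -> R.
Implicit Types X Y : 'rV[R]_m.+1.

Definition vertical_map (X : 'rV[R]_m.+1) : 'rV[R]_m.+1 :=
  \row_i (if i == ord_max then w (horiz_norm X) (X 0 ord_max) else X 0 i).

Lemma vertical_map_last X :
  vertical_map X 0 ord_max = w (horiz_norm X) (X 0 ord_max).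
Proof. by rewrite mxE eqxx. Qed.

Lemma vertical_map_other X i : i != ord_max -> vertical_map X 0 i = X 0 i.
Proof. by move=> /negbTE im; rewrite mxE im. Qed.

Let horiz_eq X Y : (forall i, i != ord_max -> X 0 i = Y 0 i) ->
  horiz_norm X = horiz_norm Y.
Proof.
by move=> h; congr Num.sqrt; apply: eq_bigr => i im; rewrite h.
Qed.

Lemma horiz_norm_vertical_map X : horiz_norm (vertical_map X) = horiz_norm X.
Proof. by apply: horiz_eq => i im; rewrite vertical_map_other. Qed.

Lemma tnorm_vertical_map_dist X Y : tnorm (vertical_map X - vertical_map Y) =
  horiz_norm (X - Y) + `|w (horiz_norm X) (X 0 ord_max) - w (horiz_norm Y) (Y 0 ord_max)|.
Proof.
have lastB : (vertical_map X - vertical_map Y) 0 ord_max =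
    w (horiz_norm X) (X 0 ord_max) - w (horiz_norm Y) (Y 0 ord_max).
  by rewrite [LHS]mxE [X in _ + X]mxE !vertical_map_last.
rewrite tnormE lastB; congr (_ + _); apply: horiz_eq => i im.
by rewrite [LHS]mxE [X in _ + X]mxE !vertical_map_other// [RHS]mxE [X in _ = _ + X]mxE.
Qed.

End vertical_map.

Lemma vertical_map_cancel (R : realType) m (w w' : R -> R -> R) :
  (forall s t, 0 <= s -> w' s (w s t) = t) ->
  cancel (@vertical_map R m w) (vertical_map w').
Proof.
move=> h X; apply/rowP => i; have [->|im] := eqVneq i ord_max.
  by rewrite vertical_map_last horiz_norm_vertical_map vertical_map_last h// horiz_norm_ge0.
by rewrite !vertical_map_other.
Qed.

Section vertical_map_regularity.
Context {R : realType} {m : nat}.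
Variables (phi : R -> R) (c : R).
Hypotheses (phi0 : phi 0 = 0) (phi_ge1 : forall s : R, 1 <= s -> phi s = s)
  (slope_le : forall s t : R, 0 < s -> s <= t -> phi t / t <= phi s / s)
  (c01 : 0 < c <= 1)
  (phi_exp : forall u v : R, 0 <= u -> u <= v -> c * (v - u) <= phi v - phi u)
  (phi_onto : forall y : R, 0 <= y -> exists2 x, 0 <= x & phi x = y).
Variables (w : R -> R -> R) (K : R).
Hypotheses (K0 : 0 <= K)
  (wK : forall s s' t t', 0 <= s -> 0 <= s' -> 0 < s + `|t| ->
    `|w s t - w s' t'| <= K * slope phi (s + `|t|) * (`|s - s'| + `|t - t'|))
  (dw : forall s : R, 0 < s -> exists2 E : set R, finite_set E &
    forall t, ~ E t -> derivable (w s) t 1 /\ derivable (w^~ t) s 1).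
Local Notation N := m.+2.
Local Notation W := (@vertical_map R m.+1 w).
Implicit Types X Y : 'rV[R]_N.

Let tnorm_gt0 X : X != 0 -> 0 < tnorm X.
Proof.
move=> X0; rewrite lt_neqAle tnorm_ge0 andbT eq_sym.
by apply: contra X0 => /eqP /tnorm_eq0 ->.
Qed.

(** The horizontal displacement is unchanged by the map, and a slope at least 1 absorbs it. Only X
    must differ from 0, since the slope is evaluated at X alone. *)
Lemma vertical_map_slope_le X Y : X != 0 ->
  tnorm (W X - W Y) <= (1 + K) * slope phi (tnorm X) * tnorm (X - Y).
Proof.
move=> /tnorm_gt0 X0; rewrite tnorm_vertical_map_dist.
have r1 := slope_ge1 phi_ge1 slope_le X0.
have h : horiz_norm (X - Y) <= tnorm (X - Y) by rewrite tnormE lerDl.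
have d0 := tnorm_ge0 (X - Y).
have X0' : 0 < horiz_norm X + `|X 0 ord_max| by rewrite -tnormE.
have hw := wK (Y 0 ord_max) (horiz_norm_ge0 X) (horiz_norm_ge0 Y) X0'.
rewrite -tnormE in hw.
have : `|horiz_norm X - horiz_norm Y| + `|X 0 ord_max - Y 0 ord_max| <= tnorm (X - Y).
  rewrite tnormE [(X - Y) 0 ord_max]mxE [(- Y) 0 ord_max]mxE lerD2r.
  exact: horiz_norm_dist.
set d := tnorm (X - Y) in h d0 *.
set d' := `|horiz_norm X - horiz_norm Y| + `|X 0 ord_max - Y 0 ord_max| in hw *.
set r := slope _ _ in r1 hw *.
move=> dd.
have : 0 <= (K * r) * (d - d') by rewrite mulr_ge0//; [rewrite mulr_ge0//; lra|lra].
have : 0 <= (r - 1) * d by rewrite mulr_ge0//; lra.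
lra.
Qed.

(** By symmetry X has the larger norm, so d = ||X - Y|| <= 2 ||X||. Then slope(||X||) <= 2 slope(d)
    by [slope_le2], and d slope(d) = phi(d). *)
Lemma vertical_map_modulus X Y :
  tnorm (W X - W Y) <= 2 * (1 + K) * phi (tnorm (X - Y)).
Proof.
have k0 := K0; wlog XY : X Y / tnorm Y <= tnorm X.
  move=> h; have [|/ltW] := leP (tnorm Y) (tnorm X) => hh; first exact: h.
  by rewrite -opprB tnormN -(opprB Y) tnormN; exact: h.
have [->|nXY] := eqVneq X Y.
  have z : tnorm (0 : 'rV[R]_N) = 0.
    apply/eqP; rewrite eq_le tnorm_ge0 andbT.
    by have := tnorm_le_norm (0 : 'rV[R]_N); rewrite normr0 mulr0.
  by rewrite !subrr z phi0 mulr0.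
have d0 : 0 < tnorm (X - Y) by apply: tnorm_gt0; rewrite subr_eq0.
have d2 : tnorm (X - Y) <= 2 * tnorm X.
  by have := tnormD X (- Y); rewrite tnormN; lra.
have X0 : 0 < tnorm X by lra.
have Xn0 : X != 0.
  apply/eqP => e; move: X0; rewrite e; have := tnorm_le_norm (0 : 'rV[R]_N).
  by rewrite normr0 mulr0; lra.
apply: le_trans (vertical_map_slope_le Y Xn0) _.
have := slope_le2 phi0 phi_ge1 slope_le c01 phi_exp X0 d0 d2.
rewrite (modulusE phi0 (ltW d0)) => h.
have : 0 <= (1 + K) * tnorm (X - Y) * (2 * slope phi (tnorm (X - Y)) - slope phi (tnorm X)).
  by rewrite mulr_ge0//; [rewrite mulr_ge0//; lra|lra].
lra.
Qed.

Lemma vertical_map_continuous : continuous W.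
Proof.
move=> X P /nbhs_ballP[e /= e0 eP].
have k0 := K0; pose A := 2 * (1 + K).
have A0 : 0 < A by rewrite /A; lra.
(* The radius x satisfies phi(x) = e / (2 A), so the modulus A phi stays at most e / 2 below it; the
   later division by m + 3 passes from the sup norm to [tnorm]. *)
have [x x0 xE] := phi_onto (ltW (divr_gt0 (divr_gt0 e0 A0) (ltr0n _ 2 : 0 < 2))).
have xp : 0 < x.
  rewrite lt_neqAle x0 andbT; apply/eqP => x00.
  by move: xE; rewrite -x00 phi0 => /eqP; rewrite lt_eqF// !divr_gt0.
have e1 : 0 < x / m.+3%:R by rewrite divr_gt0.
apply/nbhs_ballP; exists (x / m.+3%:R) => // Y; rewrite -ball_normE /ball_/= => XY.
apply: eP; split => // i j; rewrite ord1 /ball/=.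
have := coord_le_tnorm (W X - W Y) j; rewrite !mxE => h.
apply: le_lt_trans h _; apply: le_lt_trans (vertical_map_modulus X Y) _.
have dx : tnorm (X - Y) <= x.
  apply: le_trans (tnorm_le_norm _) _.
  by rewrite mulrC -ler_pdivlMr// ltW.
have := modulus_le c01 phi_exp (tnorm_ge0 (X - Y)) dx.
rewrite xE -/A => hp; apply: (@le_lt_trans _ _ (A * (e / A / 2))).
  by rewrite ler_wpM2l// ltW.
by rewrite (_ : A * _ = e / 2); [lra|field; lra].
Qed.

Let coord_cont (j : 'I_N) : continuous (fun X : 'rV[R]_N => X 0 j).
Proof. exact: coord_continuous. Qed.

Let horiz_norm_line X i (h : R) : i != ord_max ->
  horiz_norm (h *: delta_mx 0 i + X) =
    Num.sqrt (horiz_norm X ^+ 2 + 2 * X 0 i * h + h ^+ 2).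
Proof.
move=> im; have im' : i.+1 != N by rewrite eqSS; apply: contra im => /eqP e; apply/eqP/val_inj.
rewrite horiz_norm_sqr /horiz_norm; congr Num.sqrt.
rewrite (bigD1 i)// [in RHS](bigD1 i)//= !mxE !eqxx/=.
rewrite (eq_bigr (fun k => X 0 k ^+ 2)); first by ring.
by move=> k /andP[_ ki]; rewrite !mxE (negbTE ki) andbF mulr0 add0r.
Qed.

(** All coordinates but the last are linear. The last one is [w s] along the vertical direction;
    along a horizontal direction it is [w^~ t] composed with the square root of a quadratic
    polynomial equal to s^2 > 0 at 0. *)
Let vertical_map_derivable (x : 'rV[R]_m.+1) : x != 0 ->
  exists2 E : set R, countable E & forall t, ~ E t -> forall i j,
    derivable (fun X => W X 0 j) (snoc_rV (x, t)) (delta_mx 0 i).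
Proof.
move=> x0; pose s := enorm x.
have s0 : 0 < s.
  rewrite sqrtr_gt0 lt_neqAle sumr_ge0 ?andbT; last by move=> i _; exact: sqr_ge0.
  apply: contra x0 => /eqP/esym/eqP; rewrite psumr_eq0; last by move=> i _; exact: sqr_ge0.
  move=> /allP h; apply/eqP/rowP => i; apply/eqP; rewrite mxE -sqrf_eq0.
  by apply: h; exact: mem_index_enum.
have [E fE hE] := dw s0; exists E; first exact: finite_set_countable.
move=> t /hE[d1 d2] i j; set X := snoc_rV (x, t).
have Xs : horiz_norm X = s by exact: horiz_norm_snoc.
have Xt : X 0 ord_max = t by exact: snoc_ord_max.
have [->|jm] := eqVneq j ord_max; last first.
  rewrite (_ : (fun Y => _) = (fun Y : 'rV[R]_N => Y 0 j)); last first.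
    by apply/funext => Y; rewrite vertical_map_other.
  by apply: diff_derivable; exact: differentiable_coord.
apply/derivable1P.
have [->|im] := eqVneq i ord_max.
  rewrite (_ : (fun h : R => _) = (fun h : R => w s (h + t))); last first.
    apply/funext => h; rewrite vertical_map_last -Xs -Xt; congr w.
      congr Num.sqrt; apply: eq_bigr => k km; rewrite !mxE eqxx/=.
      case: eqP => [e|_]; last by rewrite mulr0 add0r.
      by move: km; rewrite e eqxx.
    by rewrite !mxE !eqxx mulr1.
  apply/derivable1_diffP; apply: (@differentiable_comp _ _ _ _ (fun h : R => h + t)).
    apply/derivable1_diffP.
    by apply: derivableD; [exact: derivable_id|exact: derivable_cst].
  by rewrite add0r; exact/derivable1_diffP.
rewrite (_ : (fun h : R => _) = (w^~ t) \o (Num.sqrt \o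
    (fun h : R => s ^+ 2 + 2 * X 0 i * h + h ^+ 2))); last first.
  apply/funext => h; rewrite vertical_map_last horiz_norm_line// Xs /=; congr w.
  rewrite mxE [X in X + _]mxE [X in _ * X]mxE (eq_sym ord_max) (negbTE im) andbF.
  by rewrite mulr0 add0r.
have e0 : s ^+ 2 + 2 * X 0 i * 0 + 0 ^+ 2 = s ^+ 2 by rewrite mulr0 expr0n !addr0.
apply/derivable1_diffP; apply: differentiable_comp; last first.
  by rewrite /= e0 sqrtr_sqr gtr0_norm//; exact/derivable1_diffP.
apply: differentiable_comp; last first.
  apply/derivable1_diffP; rewrite e0.
  have s20 : 0 < s ^+ 2 by rewrite exprn_gt0.
  by have [] := is_derive1_sqrt s20.
apply/derivable1_diffP; apply: derivableD; last exact: exprn_derivable.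
apply: derivableD; first exact: derivable_cst.
by apply: derivableM; [exact: derivable_cst|exact: derivable_id].
Qed.

Lemma vertical_map_W1p_loc (phi3 : cond_C3 phi N) : W1p_loc N W.
Proof.
move=> j.
apply: (@modulus_W1p_loc_fun R m phi _ _ phi_ge1 slope_le phi3 _ (1 + K)).
- by move=> s; exact: (modulus_ge0 phi0 c01 phi_exp).
- by move=> s t; exact: (modulus_le c01 phi_exp).
- by rewrite addr_ge0.
- move=> X; apply: (@continuous_comp _ _ _ W (fun Y : 'rV[R]_N => Y 0 j)).
    exact: vertical_map_continuous.
  exact: coord_cont.
- move=> X Y X0; apply: le_trans (vertical_map_slope_le Y X0).
  by have := coord_le_tnorm (W X - W Y) j; rewrite !mxE.
- move=> x x0; have [E cE hE] := vertical_map_derivable x0.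
  by exists E => // t /hE + i; apply.
Qed.

End vertical_map_regularity.

(** * Construction of H and F from the glued profile *)

Theorem theorem14p1 (R : realType) (n : nat) (n_ge2 : (2 <= n)%N)
    (phi : R -> R)
    (phi_mod : modulus_of_continuity phi) (phi_reg : phi_regular phi)
    (phi1 : cond_C1 phi) (phi2 : cond_C2 phi) (phi3 : cond_C3 phi n)
    (phi4 : cond_C4 phi) :
  exists H F : 'rV[R]_n -> 'rV[R]_n,
    homeomorphism_with_inverse H F /\
    W1p_loc n H /\ W1p_loc n F /\
    H 0 = 0 /\
    (forall X, 1 <= tnorm X -> H X = X) /\
    (forall X, height X = 0 -> H X = X) /\
    has_global_modulus phi H /\
    has_global_modulus phi F /\
    (forall r : R, 0 <= r ->
      optimal_modulus0 H r (phi r) /\ optimal_modulus0 F r (phi r)).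
Proof.
case: n n_ge2 phi3 => [//|[//|m]] _ phi3.
have [phi00 _ phi_ge1] := phi1.
have slope_le := modulus_slope_nonincreasing phi_mod phi_reg phi1 phi2.
have [c c01 phi_exp] := modulus_expanding phi_mod phi_reg phi1 phi2.
have phi_onto := modulus_onto phi_reg phi1.
have phi_is_derive := modulus_is_derive phi_mod phi_reg phi1 phi2.
pose u := glued phi; pose v s t := - glued phi s (- t).
pose K := 2 * (8 + c^-1).
have K0 : 0 <= K by rewrite /K mulr_ge0// addr_ge0// invr_ge0; lra.
have uK s s' t t' : 0 <= s -> 0 <= s' -> 0 < s + `|t| ->
    `|u s t - u s' t'| <= K * slope phi (s + `|t|) * (`|s - s'| + `|t - t'|).
  exact: glued_dist.
have vK s s' t t' : 0 <= s -> 0 <= s' -> 0 < s + `|t| ->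
    `|v s t - v s' t'| <= K * slope phi (s + `|t|) * (`|s - s'| + `|t - t'|).
  have distN (a b : R) : `|- a - - b| = `|a - b| by rewrite -opprD normrN.
  move=> s0 s'0; rewrite -(normrN t) => st; rewrite /v distN -(distN t); exact: uK.
have du s : 0 < s -> exists2 E : set R, finite_set E &
    forall t, ~ E t -> derivable (u s) t 1 /\ derivable (u^~ t) s 1.
  by move=> s0; exact: (glued_derivable phi00 phi_ge1 slope_le c01 phi_exp phi_onto phi_is_derive).
have dv s : 0 < s -> exists2 E : set R, finite_set E &
    forall t, ~ E t -> derivable (v s) t 1 /\ derivable (v^~ t) s 1.
  move=> s0; have [E fE hE] := du s s0.
  exists (-%R @` E) => [|t tE]; first exact: finite_image.
  have [|d1 d2] := hE (- t); first by move=> Et; apply: tE; exists (- t); rewrite ?opprK.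
  split; last exact: derivableN.
  apply: derivableN; apply/derivable1_diffP.
  by apply: differentiable_comp => //; exact/derivable1_diffP.
have uv s t : 0 <= s -> u s (v s t) = t.
  by move=> s0; exact: (gluedK phi00 phi_ge1 slope_le c01 phi_exp phi_onto).
have vu s t : 0 <= s -> v s (u s t) = t.
  by move=> s0; have := uv s (- t) s0; rewrite /v/= opprK => /(congr1 -%R); rewrite opprK.
exists (vertical_map u), (vertical_map v).
have horiz_ge0 := @horiz_norm_ge0 R m.+1.
(* The maximum is attained on the axis x = 0, where both norms equal |t|; elsewhere the Euclidean
   norm is at most [tnorm], which the first hypothesis on w bounds by phi(r). *)
have opt w : (forall s t, 0 <= s -> s + `|w s t| <= phi (s + `|t|)) ->
    (forall t, 0 <= t -> exists2 t', `|t'| = t & `|w 0 t'| = phi t) ->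
    forall r, 0 <= r -> optimal_modulus0 (@vertical_map R m.+1 w) r (phi r).
  move=> hw hw0 r r0; split.
    have [t tr wt] := hw0 r r0.
    pose X : 'rV[R]_m.+2 := snoc_rV (0, t).
    have hX : horiz_norm X = 0.
      by rewrite horiz_norm_snoc /enorm big1 ?sqrtr0// => i _; rewrite mxE expr0n.
    exists X => /=; first by rewrite tnormE hX snoc_ord_max add0r.
    have h : enorm (vertical_map w X) ^+ 2 = phi r ^+ 2.
      rewrite enorm_sqr horiz_norm_vertical_map hX expr0n add0r vertical_map_last hX.
      by rewrite snoc_ord_max -[LHS](real_normK (num_real _)) wt.
    apply/eqP; rewrite -(@eqrXn2 _ 2)// ?h ?sqrtr_ge0//.
    exact: (modulus_ge0 phi00 c01 phi_exp).
  move=> _ [X /= tX <-]; apply: le_trans (enorm_le_tnorm _) _.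
  rewrite tnormE horiz_norm_vertical_map vertical_map_last -tX (tnormE X).
  exact: hw.
split; first split.
- exact: (vertical_map_continuous phi00 phi_ge1 slope_le c01 phi_exp phi_onto K0 uK).
- exact: (vertical_map_continuous phi00 phi_ge1 slope_le c01 phi_exp phi_onto K0 vK).
- exact: vertical_map_cancel.
- exact: vertical_map_cancel.
split; first exact: (vertical_map_W1p_loc phi00 phi_ge1 slope_le c01 phi_exp phi_onto K0 uK du).
split; first exact: (vertical_map_W1p_loc phi00 phi_ge1 slope_le c01 phi_exp phi_onto K0 vK dv).
have fix0 (X : 'rV[R]_m.+2) : X 0 ord_max = 0 -> @vertical_map R m.+1 u X = X.
  move=> X0; apply/rowP => i; have [->|im] := eqVneq i ord_max.
    by rewrite vertical_map_last X0 /u glued0.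
  by rewrite vertical_map_other.
split; first by apply: fix0; rewrite mxE.
split.
  move=> X X1; apply/rowP => i; have [->|im] := eqVneq i ord_max.
    rewrite vertical_map_last; apply: (glued_far phi00 phi_ge1 slope_le c01 phi_exp phi_onto) => //.
    by rewrite -tnormE.
  by rewrite vertical_map_other.
split; first by move=> X; rewrite heightE; exact: fix0.
split; first by exists (2 * (1 + K)) => X Y;
  exact: (vertical_map_modulus phi00 phi_ge1 slope_le c01 phi_exp K0 uK).
split; first by exists (2 * (1 + K)) => X Y;
  exact: (vertical_map_modulus phi00 phi_ge1 slope_le c01 phi_exp K0 vK).
move=> r r0; split; apply: opt => //.
- by move=> s t s0; exact: (glued_le phi00 phi_ge1 slope_le c01 phi_exp phi_onto).
(* H attains the maximum on the upper half-axis, where u(0, t) = phi(t). *)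
- move=> t t0; exists t; first exact: ger0_norm.
  by rewrite /u (glued_0t phi00 c01 phi_exp)// ger0_norm// (modulus_ge0 phi00 c01 phi_exp).
- move=> s t s0; rewrite /v normrN -(normrN t).
  exact: (glued_le phi00 phi_ge1 slope_le c01 phi_exp phi_onto).
(* F attains it on the lower half-axis, the reflected image. *)
- move=> t t0; exists (- t); first by rewrite normrN ger0_norm.
  rewrite /v opprK normrN (glued_0t phi00 c01 phi_exp)// ger0_norm//.
  exact: (modulus_ge0 phi00 c01 phi_exp).
Qed.
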